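(* For every $n\ge 0$, $$|\mathcal{UD}_{2n}(4123)|=|\mathcal{UD}_{2n}(1234)|=\frac{2(3n)!}{n!\,(n+1)!\,(n+2)!}.$$
   Context: A permutation $\pi=\pi_1\cdots\pi_m$ of $[m]=\{1,\ldots,m\}$ is up-down alternating if $\pi_1<\pi_2>\pi_3<\pi_4>\cdots$ (the empty permutation counts as the unique element for $m=0$). It contains a pattern $\tau=\tau_1\cdots\tau_k$ if some subsequence $\pi_{i_1}\cdots\pi_{i_k}$ ($i_1<\cdots<i_k$) is order-isomorphic to $\tau$, and avoids $\tau$ otherwise. $\mathcal{UD}_m(\tau)$ denotes the set of $\tau$-avoiding up-down alternating permutations of $[m]$. *)

(* Defs.v *)
From mathcomp Require Import all_boot all_order all_algebra all_fingroup.

Set Implicit Arguments.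
Unset Strict Implicit.
Unset Printing Implicit Defensive.

(* Permutations of [m] are elements of 'S_m: positions and values are both
   shifted down by one, to {0, ..., m-1}. *)

(* Since positions start at 0, up-down means an ascent at every even
   position and a descent at every odd one. *)
Definition updown (m : nat) (p : 'S_m) : bool :=
  [forall i : 'I_m, forall j : 'I_m,
     (val j == (val i).+1) ==>
       (if odd i then val (p j) < val (p i) else val (p i) < val (p j))].

(* A pattern tau is given in one-line notation as the list of its values.
   Only their relative order is used, so they may start at 1. *)
Definition contains (m : nat) (p : 'S_m) (tau : seq nat) : bool :=
  [exists f : {ffun 'I_(size tau) -> 'I_m},
     [forall a, forall b, (val a < val b) ==> (val (f a) < val (f b))] &&
     [forall a, forall b,
        (val (p (f a)) < val (p (f b))) == (nth 0 tau a < nth 0 tau b)]].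

Definition avoids (m : nat) (p : 'S_m) (tau : seq nat) : bool :=
  ~~ contains p tau.

Definition UD (m : nat) (tau : seq nat) : {set 'S_m} :=
  [set p : 'S_m | updown p && avoids p tau].

(* Main.v *)
Require Import Defs.
From mathcomp Require Import all_boot all_order all_algebra all_fingroup.
From mathcomp Require Import zify ring lra.

(** Words are built from right to left: a permutation of length m + 1 arises from one of
    length m by prepending a letter and shifting the letters above it.

    For 1234, an even-length word is summarised by the number a (resp. b) of letters that can be
    prepended without lying below an ascending pair (resp. below a 123); prepending two letters
    produces every pair (a', b') with 2 <= a' <= a + 1 and a' < b' <= b + 2 exactly once.
    For 4123 a whole stack of positive letters has to be remembered: it encodes the gaps between
    the values x, below the least end of a 123, for which x occurs before x + 1. Prepending a
    letter pops the stack and splits or shortens its top letter.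

    Both counts are expressed in terms of the numbers f(n, j, k) of standard Young tableaux
    with three rows, extended to all j, k by the antisymmetry of the Frobenius formula. Let
    [lam n] be the linear functional x^i y^v |-> f(n, n - i, n + 1 - v) on polynomials in x, y.
    It is antisymmetric under x <-> y and the branching rule of tableaux reads
    lam (n+1) ((1 - x - y) P) = lam n (P / (x y)). With [q] = (y^q - x^q) / (y - x) one has:
    - the number of pairs (a, b) at level n with a >= a' - 1 and b >= b' - 2 is
      lam n (y^(a'-1) (x + y)^(b'-a'-1));
    - the number of stacks of odd-length words 2n + 1 whose bottom letters are a_1, ..., a_s
      is lam n (y^(a_1) prod_(i >= 2) (x y [a_i])),
      because of [p + q - 1] + x y [p - 1] [q - 1] = [p] [q].
    Both total counts at length 2n are lam n y = f(n, n, n). *)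

Set Implicit Arguments.
Unset Strict Implicit.
Unset Printing Implicit Defensive.

Import Order.TTheory GRing.Theory Num.Theory.
Local Open Scope ring_scope.

(** * The functional lam *)

(* f(a - 2, b - 1, c) for a - 2 >= b - 1 >= c, by the Frobenius formula. *)
Definition frob (a b c : nat) : rat :=
  (a%:R - b%:R) * (a%:R - c%:R) * (b%:R - c%:R) * ((a + b + c - 3)%N`!)%:R /
  ((a`! * b`! * c`!)%N)%:R.

Definition lam (n i v : nat) : rat :=
  if (i <= n.+1)%N && (v <= n.+1)%N then frob n.+2 (n.+1 - i) (n.+1 - v) else 0.

Lemma fact_neq0 n : (n`!)%:R != 0 :> rat.
Proof. by rewrite pnatr_eq0 -lt0n fact_gt0. Qed.

Lemma frob_antisym a b c : frob a c b = - frob a b c.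
Proof.
rewrite /frob (_ : a + c + b = a + b + c)%N; last by lia.
rewrite (_ : a`! * c`! * b`! = a`! * b`! * c`!)%N; last by lia.
by rewrite -[RHS]mulNr; congr (_ / _); ring.
Qed.

Lemma lam_antisym n i v : lam n v i = - lam n i v.
Proof.
rewrite /lam andbC; case: ifP => _; last by rewrite oppr0.
exact: frob_antisym.
Qed.

Lemma lam_diag n i : lam n i i = 0.
Proof. by have := lam_antisym n i i; lra. Qed.

Lemma lam0l n i v : (n.+1 < i)%N -> lam n i v = 0.
Proof. by rewrite ltnNge /lam => /negbTE ->. Qed.

Lemma lam0r n i v : (n.+1 < v)%N -> lam n i v = 0.
Proof. by rewrite ltnNge /lam andbC => /negbTE ->. Qed.

(* The weights in the four terms of the recurrence over the common denominator. *)
Lemma frob_identity (a b c : rat) :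
  (a + b + c - 3) * ((a - b) * (a - c) * (b - c)) =
  a * ((a - 1 - b) * (a - 1 - c) * (b - c)) +
  b * ((a - (b - 1)) * (a - c) * (b - 1 - c)) +
  c * ((a - b) * (a - (c - 1)) * (b - (c - 1))).
Proof. ring. Qed.

(** Stands for [frob a b (c - 1)], with 0 at c = 0, where the row has no box to remove. *)
Definition frobd (a b c : nat) : rat := if c is c'.+1 then frob a b c' else 0.

Lemma frobdE a b c : (3 < a + b + c)%N -> frobd a b c =
  c%:R * ((a%:R - b%:R) * (a%:R - (c%:R - 1)) * (b%:R - (c%:R - 1))) *
  ((a + b + c - 4)%N`!)%:R / ((a`! * b`! * c`!)%N)%:R.
Proof.
case: c => [|c] h; first by rewrite /frobd !mul0r.
rewrite /frobd /frob (_ : a + b + c.+1 - 4 = a + b + c - 3)%N; last by lia.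
rewrite factS (_ : a`! * b`! * (c.+1 * c`!) = c.+1 * (a`! * b`! * c`!))%N; last by lia.
rewrite (_ : c.+1%:R - 1 = c%:R); last by rewrite -natr1 addrK.
by rewrite [X in _ / X]natrM; field; rewrite !fact_neq0 addrC natr1 pnatr_eq0.
Qed.

(** Branching rule: the largest entry sits at the end of one of the three rows. Antisymmetry turns
    the middle-row term into [- frobd a.+1 c b]. The hypothesis keeps the subtraction inside the
    factorial from truncating. *)
Lemma frob_rec a b c : (3 < a.+1 + b + c)%N ->
  frob a.+1 b c = frob a b c - frobd a.+1 c b + frobd a.+1 b c.
Proof.
move=> h; rewrite !frobdE //; last by lia.
rewrite /frob.
rewrite (_ : a.+1 + b + c - 3 = (a + b + c - 3).+1)%N; last by lia.
rewrite (_ : a.+1 + c + b - 4 = a + b + c - 3)%N; last by lia.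
rewrite (_ : a.+1 + b + c - 4 = a + b + c - 3)%N; last by lia.
rewrite (_ : a.+1`! * c`! * b`! = a.+1`! * b`! * c`!)%N; last by lia.
rewrite [in X in X = _]factS factS.
have h1 : (a + b + c - 3).+1%:R = a.+1%:R + b%:R + c%:R - 3 :> rat.
  have -> : (a + b + c - 3).+1 = (a + b + c - 2)%N by lia.
  by rewrite natrB; [rewrite !natrD -natr1; ring | lia].
have ha : a.+1%:R != 0 :> rat by rewrite pnatr_eq0.
have hd : (a`! * b`! * c`!)%N%:R != 0 :> rat.
  by rewrite !natrM !mulf_neq0 // fact_neq0.
have hE : (a.+1 * a`! * b`! * c`!)%N%:R = a.+1%:R * (a`! * b`! * c`!)%N%:R :> rat.
  by rewrite -natrM !mulnA.
rewrite !hE.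
have := frob_identity a.+1%:R b%:R c%:R.
rewrite -h1 natrM.
have -> : a.+1%:R - 1 = a%:R :> rat by rewrite -natr1 addrK.
move=> hid.
move: (a`! * b`! * c`!)%N%:R hd => D hd.
move: ((a + b + c - 3)`!)%:R => N.
move: (a + b + c - 3).+1%:R hid => X hid.
move: a.+1%:R a%:R b%:R c%:R ha hid => A a0 b0 c0 hA hid.
apply: (@mulfI _ (A * D)); first by rewrite mulf_neq0.
transitivity (N * (X * ((A - b0) * (A - c0) * (b0 - c0)))).
  by field; rewrite hA hd.
by rewrite hid; field; rewrite hA hd.
Qed.

(** Removing a box from the second or third row multiplies by x or y; removing one from the first
    row lowers n and divides by x y. If i = 0 or v = 0, the first-row term vanishes because two
    arguments of [frob] coincide. *)
Lemma lam_rec n i v :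
  lam n.+1 i v - lam n.+1 i.+1 v - lam n.+1 i v.+1 =
  if (i > 0)%N && (v > 0)%N then lam n i.-1 v.-1 else 0.
Proof.
case: (leqP i n.+2) => hi; last first.
  rewrite !lam0l; [|lia..]; rewrite !subr0.
  by case: ifP => // _; rewrite ?lam0l //; lia.
case: (leqP v n.+2) => hv; last first.
  rewrite !lam0r; [|lia..]; rewrite !subr0.
  by case: ifP => // _; rewrite ?lam0r //; lia.
(* At i = v = n + 2 all terms vanish, being diagonal or out of range. This case is set apart because
   at n = 0 it violates the hypothesis of [frob_rec]. *)
have [hE|hne] := eqVneq (n.+2 - i + (n.+2 - v))%N 0%N.
  have -> : i = n.+2 by lia.
  have -> : v = n.+2 by lia.
  rewrite /= !lam_diag lam0l ?lam0r ?lam_diag //; lra.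
have h : (3 < n.+3 + (n.+2 - i) + (n.+2 - v))%N by lia.
have hl : lam n.+1 i v = frob n.+3 (n.+2 - i) (n.+2 - v) by rewrite /lam hi hv.
have hr : lam n.+1 i v.+1 = frobd n.+3 (n.+2 - i) (n.+2 - v).
  rewrite /lam hi /=; case: ifP => hv'.
    by have -> : (n.+2 - v = (n.+2 - v.+1).+1)%N by lia.
  by have -> : (n.+2 - v = 0)%N by lia.
have hrl : lam n.+1 i.+1 v = - frobd n.+3 (n.+2 - v) (n.+2 - i).
  rewrite /lam hv andbT; case: ifP => hv'.
    have -> : (n.+2 - i = (n.+2 - i.+1).+1)%N by lia.
    exact: frob_antisym.
  have -> : (n.+2 - i = 0)%N by lia.
  by rewrite oppr0.
rewrite hl hr hrl frob_rec //.
rewrite (_ : forall x y z : rat, x - y + z - - y - z = x); last by move=> *; ring.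
case: ifP => hiv.
  rewrite /lam ifT; last by lia.
  by congr frob; lia.
have hz : (i = 0 \/ v = 0)%N by lia.
by rewrite /frob; case: hz => ->; rewrite subn0 subrr ?(mul0r, mulr0).
Qed.

(** This is f(n, n, n), for which the product of differences in the Frobenius formula is 1 * 2 *
    1. *)
Lemma lam_total n :
  lam n 0 1 = (2 * (3 * n)`!)%:R / (n`! * n.+1`! * n.+2`!)%:R.
Proof.
rewrite /lam /= /frob subn0 subn1 /= (_ : n.+2 + n.+1 + n - 3 = 3 * n)%N; last by lia.
rewrite (_ : n.+2`! * n.+1`! * n`! = n`! * n.+1`! * n.+2`!)%N; last by lia.
congr (_ / _); rewrite [RHS]natrM; congr (_ * _).
by rewrite -![n.+2%:R]natr1 -![n.+1%:R]natr1; ring.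
Qed.

(** * Polynomials in x and y acting on lam *)

(* [bracket f a] is the functional P |-> f (P [a]). *)
Definition bracket (f : nat -> nat -> rat) (a i v : nat) : rat :=
  \sum_(t < a) f (i + t)%N (v + (a.-1 - t))%N.

Lemma br0 f i v : bracket f 0 i v = 0.
Proof. by rewrite /bracket big_ord0. Qed.

Lemma br1 f i v : bracket f 1 i v = f i v.
Proof. by rewrite /bracket big_ord1 !addn0. Qed.

Lemma eq_br f g : f =2 g -> forall a, bracket f a =2 bracket g a.
Proof. by move=> e a i v; apply: eq_bigr => t _. Qed.

Lemma brSr f a i v : bracket f a.+1 i v = bracket f a i v.+1 + f (i + a)%N v.
Proof.
rewrite /bracket big_ord_recr /= subnn addn0; congr (_ + _).
by apply: eq_bigr => t _; congr f; have := ltn_ord t; lia.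
Qed.

Lemma brSl f a i v : bracket f a.+1 i v = f i (v + a)%N + bracket f a i.+1 v.
Proof.
rewrite /bracket big_ord_recl /= subn0 addn0; congr (_ + _).
by apply: eq_bigr => t _; rewrite /bump; congr f; have := ltn_ord t; lia.
Qed.

Lemma brSS f a i v :
  bracket f a.+2 i v = f i (v + a.+1)%N + bracket f a i.+1 v.+1 + f (i + a.+1)%N v.
Proof. by rewrite brSr brSl addSnnS. Qed.

Lemma br_shift f p a i v :
  bracket (fun i v => bracket f p i.+1 v.+1) a i v = bracket (bracket f p) a i.+1 v.+1.
Proof. by apply: eq_bigr => t _; rewrite !addSn. Qed.

(* [p + q + 1] + x y [p] [q] = [p + 1] [q + 1]. *)
Lemma br_mul f p q i v :
  bracket f (p + q).+1 i v + bracket (bracket f p) q i.+1 v.+1 = bracket (bracket f p.+1) q.+1 i v.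
Proof.
elim: q v => [|q IH] v; first by rewrite addn0 br0 addr0 br1.
rewrite [RHS]brSr -IH addnS [bracket f (p + q).+2 i v]brSr [bracket (bracket f p) q.+1 _ _]brSr.
rewrite [bracket f p.+1 _ _]brSr addSnnS.
rewrite (_ : i + q.+1 + p = i + (p + q).+1)%N; last by lia.
ring.
Qed.

(** [a] is symmetric in x and y, so an antisymmetric functional kills (x y)^i [a]. *)
Lemma br_antisym f a i : (forall i v, f v i = - f i v) -> bracket f a i i = 0.
Proof.
move=> h; suff: bracket f a i i = - bracket f a i i by lra.
rewrite {1}/bracket (reindex_inj rev_ord_inj) /= -sumrN; apply: eq_bigr => t _.
by rewrite h; congr (- f _ _); have := ltn_ord t; lia.
Qed.

(* For b = (a_s, ..., a_1): x^i y^v |-> lam n (x^i y^v y^(a_1) prod_(j >= 2) (x y [a_j])). *)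
Fixpoint lamw (n : nat) (b : seq nat) : nat -> nat -> rat :=
  if b is a :: b' then
    if b' is [::] then fun i v => lam n i (v + a)%N
    else fun i v => bracket (lamw n b') a i.+1 v.+1
  else fun _ _ => 0.

Lemma lamw_cons n a c b i v :
  lamw n (a :: c :: b) i v = bracket (lamw n (c :: b)) a i.+1 v.+1.
Proof. by []. Qed.

Lemma lamw0 n b i v : (n.*2.+2 < i + v)%N -> lamw n b i v = 0.
Proof.
elim: b i v => [|a [|c b] IH] i v h //.
  rewrite /=; case: (leqP i n.+1) => hi; last by rewrite lam0l.
  by rewrite lam0r //; lia.
rewrite lamw_cons /bracket big1 // => t _; apply: IH; have := ltn_ord t; lia.
Qed.

(** Each letter above the bottom one contributes a factor x, and [lam n] kills powers of x beyond n
    + 1. *)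
Lemma lamw_long n b i v : (n.+2 < i + size b)%N -> lamw n b i v = 0.
Proof.
elim: b i v => [|a [|c b] IH] i v h //.
  by rewrite /= lam0l //; move: h => /=; lia.
rewrite lamw_cons /bracket big1 // => t _; apply: IH; move: h => /=; lia.
Qed.

Lemma br_lamw0 n b a i v : (n.*2.+3 < a + i + v)%N -> bracket (lamw n b) a i v = 0.
Proof. by move=> h; rewrite /bracket big1 // => t _; apply: lamw0; have := ltn_ord t; lia. Qed.

Lemma brbr_lamw0 n b a c i v : (n.*2 + 4 < a + c + i + v)%N ->
  bracket (bracket (lamw n b) a) c i v = 0.
Proof.
by move=> h; rewrite /bracket big1 // => t _; apply: br_lamw0; have := ltn_ord t; lia.
Qed.

(** The left side adds the two origins of an even-length stack with top letters q + 1 and p + 1: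
    cutting a letter p + q + 1, or raising the letters q and p. Above a nonempty [b] the identity is
    [br_mul]; otherwise it is [q + 1] = y^q + x [q]. *)
Lemma lamw_split n p q b :
  lamw n ((p + q).+1 :: b) 0 0 +
    (if (0 < p)%N && (0 < q)%N then lamw n [:: q, p & b] 0 0 else 0) =
  bracket (lamw n (p.+1 :: b)) q.+1 0 0.
Proof.
case: b => [|c b].
  rewrite [RHS]brSl [in RHS]/= !add0n (_ : (q + p.+1 = (p + q).+1)%N); last by lia.
  congr (_ + _).
  case: p => [|p] /=.
    (* For p = 0 the second term would be lam n (x y [q]), which antisymmetry kills. *)
    rewrite -[LHS](@br_antisym (lam n) q 1 (lam_antisym n)).
    by apply: eq_bigr => t _; rewrite /=; congr (lam n _ _); lia.
  case: q => [|q]; first by rewrite !br0.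
  by apply: eq_bigr => t _; rewrite /=; congr (lam n _ _); lia.
have -> : bracket (lamw n [:: p.+1, c & b]) q.+1 0 0 =
          bracket (bracket (lamw n (c :: b)) p.+1) q.+1 1 1 by rewrite -br_shift.
rewrite -br_mul lamw_cons; congr (_ + _).
rewrite [lamw n [:: q, p, c & b] _ _]lamw_cons.
have -> : bracket (lamw n [:: p, c & b]) q 1 1 = bracket (bracket (lamw n (c :: b)) p) q 2 2.
  by rewrite -br_shift.
case: p => [|p] /=.
  by rewrite [RHS]big1 // => t _; rewrite br0.
by case: q => [|q] //=; rewrite br0.
Qed.

Lemma lamw_rec n a b i v :
  lamw n.+1 (a :: b) i.+1 v.+1 - lamw n.+1 (a :: b) i.+2 v.+1 -
    lamw n.+1 (a :: b) i.+1 v.+2 = lamw n (a :: b) i v.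
Proof.
elim: b a i v => [|c b IH] a i v; first by rewrite /= !addSn lam_rec.
rewrite !lamw_cons /bracket -!sumrB; apply: eq_bigr => t _.
by rewrite !addSn -IH.
Qed.

Lemma lamw_rec_cons n a c b i v :
  lamw n.+1 [:: a, c & b] i v - lamw n.+1 [:: a, c & b] i.+1 v -
    lamw n.+1 [:: a, c & b] i v.+1 = bracket (lamw n (c :: b)) a i v.
Proof.
rewrite !lamw_cons /bracket -!sumrB; apply: eq_bigr => t _.
by rewrite !addSn; exact: lamw_rec.
Qed.

(** * Telescoping sums of brackets *)

Section Telescoping.
Variable F : nat -> nat -> rat.
Let G i v := F i v - F i.+1 v - F i v.+1.

(** Since (x + y) [k + 1] = [k + 2] + x y [k], the sum (1 - x - y) [k + 1] + x y [k] equals [k + 1]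
    - [k + 2]. *)
Lemma sum_br_diff K : bracket F K.+1 0 0 = 0 ->
  F 0%N 0%N = \sum_(k < K) bracket G k.+1 0 0 + \sum_(k < K) bracket F k 1 1.
Proof.
have h k : bracket G k.+1 0 0 = bracket F k.+1 0 0 - bracket F k.+2 0 0 - bracket F k 1 1.
  have -> : bracket G k.+1 0 0 = bracket F k.+1 0 0 - bracket F k.+1 1 0 - bracket F k.+1 0 1.
    rewrite /bracket -!sumrB; apply: eq_bigr => t _.
    by rewrite /G !addSn.
  have := brSS F k 0 0; rewrite {1}brSr {1}add0n; have := brSr F k.+1 0 0.
  have := brSl F k.+1 0 0; rewrite !add0n; lra.
move=> hK; rewrite -big_split /=.
have -> : \sum_(k < K) (bracket G k.+1 0 0 + bracket F k 1 1) = bracket F 1 0 0 - bracket F K.+1 0 0.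
  elim: (K) => [|k IH]; first by rewrite big_ord0 subrr.
  by rewrite big_ord_recr /= IH h; ring.
by rewrite hK br1 subr0.
Qed.

(** By the same relation, [k + 1] (1 - x) (1 - y) = ([k + 1] - [k + 2]) + x y ([k + 1] - [k]), and
    both differences telescope. *)
Lemma sum_br_diff2 K : bracket F K.+1 1 1 = 0 -> bracket F K 2 2 = 0 ->
  \sum_(k < K.+1) (bracket F k 1 1 - bracket F k 2 1 - bracket F k 1 2 + bracket F k 2 2) = F 1%N 1%N.
Proof.
have h k : bracket F k.+1 1 1 - bracket F k.+1 2 1 - bracket F k.+1 1 2 + bracket F k.+1 2 2 =
    bracket F k.+1 1 1 - bracket F k.+2 1 1 + bracket F k.+1 2 2 - bracket F k 2 2.
  have := brSS F k 1 1; have := brSr F k.+1 1 1; have := brSl F k.+1 1 1; lra.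
move=> h1 h2; rewrite big_ord_recl /= !br0 !subrr !add0r.
have -> : \sum_(k < K) (bracket F (bump 0 k) 1 1 - bracket F (bump 0 k) 2 1 -
   bracket F (bump 0 k) 1 2 + bracket F (bump 0 k) 2 2) = bracket F 1 1 1 - bracket F K.+1 1 1 + bracket F K 2 2.
  elim: (K) => [|k IH]; first by rewrite big_ord0 br0; ring.
  by rewrite big_ord_recr /= IH /bump leq0n h; ring.
by rewrite h1 h2 br1; ring.
Qed.
End Telescoping.

(** Matches the splitting of the odd-length stacks with bottom [[:: a, c & b]] into those equal to
    it (first sum) and those with a further letter k. [K] only has to exceed the degrees that [lam]
    sees. *)
Lemma lamw_unfold2 n a c b K : (n.*2 + 5 < K)%N ->
  lamw n.+1 [:: a, c & b] 0 0 =
  \sum_(k < K) bracket (bracket (lamw n (c :: b)) a) k.+1 0 0 +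
  \sum_(k < K) lamw n.+1 [:: (k : nat), a, c & b] 0 0.
Proof.
move=> hK; rewrite (sum_br_diff (K := K)); last by rewrite br_lamw0 //; lia.
congr (_ + _); apply: eq_bigr => k _; apply: eq_br => i v.
exact: lamw_rec_cons.
Qed.

Lemma lamw_unfold1 n a K : (n.*2 + 5 < K)%N ->
  lamw n.+1 [:: a.+1] 0 0 =
  (if (0 < a)%N then \sum_(k < K) bracket (lamw n [:: a]) k.+1 0 0 else 0) +
  \sum_(k < K) lamw n.+1 [:: (k : nat); a.+1] 0 0.
Proof.
move=> hK; rewrite (sum_br_diff (K := K.+1)); last by rewrite br_lamw0 //; lia.
congr (_ + _); last first.
  have : bracket (lamw n.+1 [:: a.+1]) K 1 1 = 0 by apply: br_lamw0; lia.
  by rewrite big_ord_recr /= => ->; rewrite addr0.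
(* The branching rule drops the pure power of y in [k + 1] and divides the rest by x, leaving [k];
   hence the one extra telescoping term. *)
transitivity (\sum_(k < K) bracket (lamw n [:: a]) k.+1 0 0).
  rewrite big_ord_recl /= br1 lam_rec /= add0r.
  apply: eq_bigr => k _; rewrite /bump leq0n add1n brSl /=.
  rewrite !lam_rec /= add0r; apply: eq_bigr => t _.
  by rewrite lam_rec /= addnS add0n.
case: ifP => // /negbT; rewrite -leqNgt leqn0 => /eqP ->.
rewrite big1 // => k _; rewrite -[RHS](@br_antisym (lam n) k.+1 0 (lam_antisym n)).
by apply: eq_bigr => t _; rewrite /= addn0.
Qed.

(* lam n (y^(a_1) prod_(j >= 2) (x y [a_j]) (1 - x) (1 - y)) counts even-length words. *)
Definition lamv n b : rat :=
  lamw n b 0 0 - lamw n b 1 0 - lamw n b 0 1 + lamw n b 1 1.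

(** In (1 - x) (1 - y) = (1 - x - y) + x y, the first part gives the stacks equal to [a.+1 :: b],
    and the second telescopes over the next letter. *)
Lemma lamv_unfold n a b K : (n.*2 + 5 < K)%N ->
  lamv n.+1 (a.+1 :: b) =
  (if b is c :: b' then bracket (lamw n b) a.+1 0 0 else 0) +
  \sum_(k < K) lamv n.+1 [:: (k : nat), a.+1 & b].
Proof.
case: K => [|K] hK //.
rewrite (sum_br_diff2 (F := lamw n.+1 (a.+1 :: b))) /lamv; try by apply: br_lamw0; lia.
congr (_ + _); case: b => [|c b]; first by rewrite /= lam_rec.
exact: lamw_rec_cons.
Qed.

(** The sum of y^(p + 1) (1 - y) telescopes to y, and y (1 - x) has the same value as y because x y
    is diagonal. *)
Lemma sum_lamv n K : (n.+1 < K)%N -> \sum_(p < K) lamv n [:: p.+1] = lam n 0 1.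
Proof.
move=> hK; transitivity (lam n 0 1 - lam n 1 1 - (lam n 0 K.+1 - lam n 1 K.+1)).
  elim: (K) => [|k IH]; first by rewrite big_ord0 subrr.
  by rewrite big_ord_recr /= IH /lamv /= !add0n !add1n; ring.
by rewrite lam_diag !(@lam0r _ _ K.+1) ?subrr ?subr0 //; lia.
Qed.

(* x^i y^v |-> lam n (x^i y^v (x + y)^m). *)
Fixpoint lams (n m i v : nat) : rat :=
  if m is m'.+1 then lams n m' i.+1 v + lams n m' i v.+1 else lam n i v.

Lemma lams_antisym n m i v : lams n m v i = - lams n m i v.
Proof.
elim: m i v => [|m IH] i v /=; first exact: lam_antisym.
by rewrite (IH i v.+1) (IH i.+1 v) opprD addrC.
Qed.

Lemma lams_diag n m i : lams n m i i = 0.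
Proof. by have := lams_antisym n m i i; lra. Qed.

(** In degree 2n + 2 the only monomial within range is the diagonal (x y)^(n + 1), so vanishing
    already starts there. *)
Lemma lams0 n m i v : (n.*2.+1 < m + i + v)%N -> lams n m i v = 0.
Proof.
elim: m i v => [|m IH] i v h /=; last by rewrite !IH ?addr0 //; lia.
case: (leqP i n.+1) => hi; last by rewrite lam0l.
case: (leqP v n.+1) => hv; last by rewrite lam0r.
by rewrite (_ : i = v) ?lam_diag //; lia.
Qed.

Lemma lams_rec n m i v :
  lams n.+1 m i.+1 v.+1 - lams n.+1 m.+1 i.+1 v.+1 = lams n m i v.
Proof.
elim: m i v => [|m IH] i v.
  by have := lam_rec n i.+1 v.+1; rewrite /=; lra.
have h1 := IH i.+1 v; have h2 := IH i v.+1; move: h1 h2; rewrite /=; lra.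
Qed.

(** The branching rule kills monomials free of x, so (x + y)^m may be replaced by (x + y)^m - y^m,
    which is x times the sum of y^r (x + y)^(m - 1 - r) over r < m. *)
Lemma lams_rec0 n m v :
  lams n.+1 m 0 v.+1 - lams n.+1 m.+1 0 v.+1 =
  \sum_(r < m) lams n (m.-1 - r) 0 (v + r).
Proof.
elim: m v => [|m IH] v.
  by have := lam_rec n 0 v.+1; rewrite big_ord0 /=; lra.
rewrite big_ord_recl subn0 addn0; have := lams_rec n m 0 v; have := IH v.+1.
have -> : \sum_(i < m) lams n (m.+1.-1 - lift ord0 i) 0 (v + lift ord0 i) =
          \sum_(r < m) lams n (m.-1 - r) 0 (v.+1 + r).
  by apply: eq_bigr => r _; rewrite /= /bump leq0n; congr lams; lia.
by rewrite /=; lra.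
Qed.

(** * Stacks for 4123 *)

Local Close Scope ring_scope.
(* A stack is a list of positive letters, top first. *)
Definition stack_top (w : seq nat) : nat := sumn (map S w).

Arguments stack_top : simpl never.

Definition incr_top (w : seq nat) : seq nat := if w is a :: w' then a.+1 :: w' else [::].

(* The state after prepending [v] to an odd-length word with stack [w]; the new top letter
   encodes the least end of a 123. *)
Fixpoint stack_split (w : seq nat) (v : nat) : seq nat :=
  if w is a :: w' then
    if v.+2 <= stack_top w' then stack_split w' v
    else if v.+2 == (stack_top w').+1 then a.+1 :: incr_top w'
    else [:: stack_top w + 1 - v.+2, v.+1 - stack_top w' & w']
  else [::].

Definition stack_splits (w : seq nat) : seq (seq nat) :=
  [seq stack_split w v | v <- iota 0 (stack_top w).-1].

(** Acts on the state of an even-length word. In the equality case v is inserted between the values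
    x and x + 1 of the topmost recorded pair, which gives way to the pair v, v + 1. *)
Definition stack_dec (u : seq nat) (v : nat) : seq nat :=
  if u is k :: w then
    if v.+2 == (stack_top w).+1 then incr_top w else v.+1 - stack_top w :: w
  else [::].

Definition stack_decs (u : seq nat) : seq (seq nat) :=
  [seq stack_dec u v | v <- iota (stack_top (behead u)).-1 (head 0 u).+1].

Fixpoint odds4123 (n : nat) : seq (seq nat) :=
  if n is n'.+1 then flatten (map stack_decs (flatten (map stack_splits (odds4123 n')))) else [:: [:: 1]].

Definition evens4123 (n : nat) : seq (seq nat) := flatten (map stack_splits (odds4123 n)).

Lemma top_cons a w : stack_top (a :: w) = (a + stack_top w).+1.
Proof. by rewrite /stack_top /= addSn. Qed.

(** Small v act below the letter a, one v raises a and the next letter, and each of the last a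
    values cuts a + 1 into two positive parts. *)
Lemma splits_cons a w : stack_splits (a :: w) =
  stack_splits w ++ (if w is c :: w' then [:: [:: a.+1, c.+1 & w']] else [::]) ++
  [seq [:: a.+1 - h, h & w] | h <- iota 1 a].
Proof.
rewrite /stack_splits top_cons; case: w => [|c w].
  rewrite /= addn0 (iotaDl 1 0) -map_comp; apply/eq_in_map => v.
  by rewrite mem_iota /= => h; congr [:: _; _]; rewrite ?top_cons /stack_top /=; lia.
rewrite succnK top_cons succnK (_ : a + (c + stack_top w).+1 = (c + stack_top w) + a.+1); last by lia.
rewrite iotaD map_cat add0n -[RHS]/(_ ++ _); congr (_ ++ _).
  apply/eq_in_map => v; rewrite mem_iota [LHS]/= => h.
  by rewrite ifT // top_cons; lia.
rewrite -/(iota _ _) /= !top_cons; congr (_ :: _).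
  by rewrite ifF ?ifT //; lia.
rewrite -addn1 iotaDl -map_comp; apply/eq_in_map => h; rewrite mem_iota => hh.
rewrite /= !ifF; [|lia..].
by congr [:: _, _ & _]; lia.
Qed.

Lemma suffix_cons_eq (b : seq nat) x w :
  suffix b (x :: w) = (b == x :: w) + suffix b w :> nat.
Proof.
have [->|ne] := eqVneq b (x :: w).
  rewrite suffix_refl; case h : (suffix _ w) => //.
  by move/size_suffix: h; rewrite ltnn.
congr nat_of_bool; apply/suffixP/suffixP => -[[|y u]] e.
- by move: e ne => /= ->; rewrite eqxx.
- by exists u; case: e.
- by exists [:: x]; rewrite e.
- by exists [:: x, y & u]; rewrite e.
Qed.

Lemma suffix_unfold (b w : seq nat) N : all (ltn^~ N) w ->
  suffix b w = (w == b) + \sum_(k < N) suffix ((k : nat) :: b) w :> nat.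
Proof.
elim: w => [|x w IH] /=.
  rewrite suffixs0 eq_sym big1 ?addn0 // => k _.
  by rewrite suffixs0.
move=> /andP[hx hw]; rewrite suffix_cons_eq (IH hw) eq_sym; congr (_ + _).
under eq_bigr => k _ do rewrite suffix_cons_eq.
rewrite big_split /=; congr (_ + _).
rewrite (bigD1 (Ordinal hx)) //= big1 ?addn0; first by rewrite eqseq_cons eqxx eq_sym.
by move=> k; rewrite -val_eqE /= eqseq_cons => /negbTE ->.
Qed.

Lemma count_splits p q b w : all (leq 1) w ->
  count_mem [:: q.+1, p.+1 & b] (stack_splits w) =
  suffix ((p + q).+1 :: b) w + ((0 < p) && (0 < q)) * suffix [:: q, p & b] w.
Proof.
elim: w => [|a w IH] /=; first by rewrite !suffixs0 muln0.
move=> /andP[ha hw]; rewrite splits_cons !count_cat (IH hw) !suffix_cons_eq.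
have -> : count_mem [:: q.+1, p.+1 & b] [seq [:: a.+1 - h, h & w] | h <- iota 1 a] =
    ((p + q).+1 :: b == a :: w).
  rewrite count_map /= eqseq_cons.
  rewrite (@eq_in_count _ _ (fun h => (h == p.+1) && (((p + q).+1 == a) && (b == w)))).
    case h0 : (((p + q).+1 == a) && (b == w)); last first.
      by under eq_count do rewrite andbF; rewrite count_pred0.
    under eq_count do rewrite andbT; move: h0 => /andP[/eqP <- _].
    by rewrite count_uniq_mem ?iota_uniq // mem_iota; lia.
  move=> h; rewrite mem_iota /= !eqseq_cons (eq_sym w b) => hh.
  by case: (b == w); rewrite ?andbT ?andbF //; lia.
have -> : count_mem [:: q.+1, p.+1 & b]
      (if w is c :: w' then [:: [:: a.+1, c.+1 & w']] else [::]) =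
    ((0 < p) && (0 < q)) * ([:: q, p & b] == a :: w).
  case: w hw {IH} => [|c w] /= hw.
    by rewrite eqseq_cons andbF muln0.
  rewrite addn0 !eqseq_cons !eqSS (eq_sym q) (eq_sym p) (eq_sym b).
  case: eqP => [<-|_]; last by rewrite muln0.
  case: eqP => [<-|_]; last by rewrite muln0.
  by move: hw => /andP[-> _]; rewrite ha mul1n.
by rewrite mulnDr; ring.
Qed.

Lemma decs_cons k c w :
  stack_decs [:: k, c & w] = (c.+1 :: w) :: [seq h :: c :: w | h <- iota 1 k].
Proof.
rewrite /stack_decs /= top_cons /=; congr (_ :: _); first by rewrite ifT.
rewrite -[X in iota X]addn1 iotaDl -map_comp; apply/eq_in_map => h; rewrite mem_iota => hh /=.
by rewrite -!/(stack_top w) ifF; [congr (_ :: _)|]; lia.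
Qed.

Lemma count_decs q b k c w :
  count_mem (q.+1 :: b) (stack_decs [:: k, c & w]) =
  ((q < k) && (c :: w == b)) + (c :: w == q :: b).
Proof.
rewrite decs_cons /= count_map addnC eqseq_cons eqSS -eqseq_cons; congr (_ + _).
rewrite (@eq_in_count _ _ (fun h => (h == q.+1) && (c :: w == b))); last first.
  by move=> h _; rewrite /= eqseq_cons.
case: (c :: w == b); last first.
  by under eq_count do rewrite andbF; rewrite count_pred0 andbF.
under eq_count do rewrite andbT.
by rewrite count_uniq_mem ?iota_uniq // mem_iota andbT; lia.
Qed.

Definition bounded (N : nat) (w : seq nat) := all (leq 1) w && (stack_top w <= N).

Lemma bounded_cons N a w : bounded N (a :: w) ->
  [/\ 0 < a, bounded N w & a + stack_top w < N].
Proof.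
rewrite /bounded /= top_cons => /andP[/andP[-> ->] h]; split => //.
by apply: leq_trans h; lia.
Qed.

Lemma mem_bounded N w : bounded N w -> all (ltn^~ N) w.
Proof.
elim: w => //= a w IH /bounded_cons[_ /IH -> h]; rewrite andbT.
by apply: leq_ltn_trans h; rewrite leq_addr.
Qed.

Lemma size_bounded N w : bounded N w -> size w <= N.
Proof.
move=> /andP[_ h]; apply: leq_trans h.
by elim: w => //= a w IH; rewrite top_cons ltnS (leq_trans IH) // leq_addl.
Qed.

Lemma splits_bounded N w u : bounded N w -> u \in stack_splits w ->
  (1 < size u) && bounded N.+2 u.
Proof.
elim: w => [|a w IH] //; rewrite splits_cons !mem_cat.
move=> /bounded_cons[ha hw hN]; case/or3P => [hu|hu|].
- by apply: IH.
- case: w {IH} hu hw hN => [|c w] //; rewrite inE => /eqP ->.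
  move=> /bounded_cons[hc /andP[hw _] _]; rewrite /bounded /= hw !top_cons; lia.
move=> /mapP[h]; rewrite mem_iota => hh ->.
by move: hw => /andP[hw _]; rewrite /bounded /= hw !top_cons; lia.
Qed.

Lemma decs_bounded N u w : 1 < size u -> bounded N u -> w \in stack_decs u ->
  (0 < size w) && bounded N w.
Proof.
case: u => [|k [|c u]] // _ /bounded_cons[hk hu hN]; rewrite decs_cons inE.
move: hu hN => /andP[/= /andP[hc hu] _]; rewrite top_cons => hN; case/orP => [/eqP ->|].
  by rewrite /bounded /= hu top_cons; lia.
move=> /mapP[h]; rewrite mem_iota => hh ->; rewrite /bounded /= hu hc !top_cons; lia.
Qed.

Lemma odds4123_bounded n w : w \in odds4123 n -> (0 < size w) && bounded n.*2.+2 w.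
Proof.
elim: n w => [|n IH] w; first by rewrite inE => /eqP ->.
move=> /flattenP[_ /mapP[u /flattenP[_ /mapP[w' hw' ->] hu ->]]].
have /andP[_ hb] := IH _ hw'; have /andP[h2 hbu] := splits_bounded hb hu.
exact: decs_bounded.
Qed.

Lemma evens4123_bounded n u : u \in evens4123 n -> (1 < size u) && bounded n.+1.*2.+2 u.
Proof.
move=> /flattenP[_ /mapP[w /odds4123_bounded /andP[_ hb] ->] hu].
exact: splits_bounded hb hu.
Qed.

Local Open Scope ring_scope.

(** * Counting stacks by their bottom letters *)

(** The number of stacks with a given suffix obeys the recurrence assumed of [phi]: the exact count
    plus a sum over the next letter. Descending induction on the length of the suffix, starting
    beyond N where both vanish, identifies the two. *)
Lemma count_suffix_unique (s : seq (seq nat)) N (phi : seq nat -> rat) :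
  (forall w, w \in s -> bounded N w) ->
  (forall a b, all (leq 1) (a :: b) -> phi (0%N :: a :: b) = 0) ->
  (forall b, (N < size b)%N -> phi b = 0) ->
  (forall a b, all (leq 1) (a :: b) ->
     phi (a :: b) = (count_mem (a :: b) s)%:R + \sum_(k < N) phi [:: (k : nat), a & b]) ->
  forall a b, all (leq 1) (a :: b) -> (count (suffix (a :: b)) s)%:R = phi (a :: b).
Proof.
move=> hs h0 hlong hrec a b.
have [m hm] : exists m, (N < size (a :: b) + m)%N by exists N.+1; lia.
elim: m a b hm => [|m IH] a b hm hab.
  rewrite hlong; last by lia.
  rewrite (eq_in_count (a2 := pred0)) ?count_pred0 // => w /hs /size_bounded hw /=.
  apply/negP => /size_suffix h; move: hm; rewrite addn0 ltnNge => /negP[].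
  exact: leq_trans h hw.
rewrite hrec //.
under eq_bigr => k _.
  rewrite (_ : phi _ = (count (suffix ((k : nat) :: a :: b)) s)%:R); first over.
  case: k => -[|k] hk /=; last by rewrite IH //=; move: hm => /=; lia.
  rewrite h0 //; rewrite (eq_in_count (a2 := pred0)) ?count_pred0 // => w /hs /andP[hw _].
  by apply/negP => /suffixP[u e]; move: hw; rewrite e all_cat /= andbF.
rewrite -natr_sum -natrD; congr (_%:R).
rewrite -!sum1_count big_mkcond /= [X in (_ + X)%N](eq_bigr (fun k : 'I_N =>
   \sum_(w <- s) (suffix ((k : nat) :: a :: b) w : nat)))%N; last first.
  by move=> k _; rewrite -sum1_count big_mkcond.
rewrite [X in (X + _)%N]big_mkcond exchange_big -big_split /=.
rewrite !big_seq; apply: eq_bigr => w /hs hw.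
exact: (suffix_unfold _ (mem_bounded hw)).
Qed.

Lemma count_flatten_map (T T' : eqType) (p : pred T) (f : T' -> seq T) s :
  count p (flatten (map f s)) = (\sum_(w <- s) count p (f w))%N.
Proof. by rewrite count_flatten sumnE !big_map. Qed.

Lemma count_evens4123 n p q b :
  count_mem [:: q.+1, p.+1 & b] (evens4123 n) =
  (count (suffix ((p + q).+1 :: b)) (odds4123 n) +
   ((0 < p) && (0 < q)) * count (suffix [:: q, p & b]) (odds4123 n))%N.
Proof.
rewrite count_flatten_map big_seq.
under eq_bigr => w /odds4123_bounded /andP[_ /andP[hw _]] do rewrite (count_splits _ _ _ hw).
rewrite -big_seq big_split /= -big_distrr /=.
by congr (_ + _ * _)%N; rewrite -sum1_count [RHS]big_mkcond.
Qed.

Lemma sum_eq_cons (N q k : nat) (b w : seq nat) : (k < N)%N ->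
  (\sum_(j < N) (q <= j) * (k :: w == (j : nat) :: b) = (q <= k) && (w == b))%N.
Proof.
move=> hk; rewrite (bigD1 (Ordinal hk)) //= big1 ?addn0.
  by rewrite eqseq_cons eqxx mulnb.
by move=> j; rewrite -val_eqE /= eqseq_cons eq_sym => /negbTE ->; rewrite muln0.
Qed.

(** The stack [q.+1 :: b] arises from [k :: b] with q < k by shortening k, or from [[:: k, q & b]]
    by popping k and raising q. *)
Lemma count_odds4123S n q b (N := n.+1.*2.+2) :
  count_mem (q.+1 :: b) (odds4123 n.+1) =
  (\sum_(k < N) (q < k) * count_mem ((k : nat) :: b) (evens4123 n) +
   \sum_(k < N) count_mem [:: (k : nat), q & b] (evens4123 n))%N.
Proof.
rewrite /= -/(evens4123 n) count_flatten_map.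
transitivity (\sum_(u <- evens4123 n) (\sum_(k < N) (q < k) * (u == (k : nat) :: b) +
  \sum_(k < N) (u == [:: (k : nat), q & b]))%N)%N.
  rewrite !big_seq; apply: eq_bigr => u /evens4123_bounded /andP[].
  case: u => [|k [|c w]] // _ hb; rewrite count_decs.
  have hk : (k < N)%N by have /andP[] := mem_bounded hb.
  rewrite sum_eq_cons //; congr (_ + _)%N.
  by have := sum_eq_cons 0 (q :: b) (c :: w) hk; under eq_bigr do rewrite mul1n.
rewrite big_split /=; congr (_ + _)%N; rewrite exchange_big /=; apply: eq_bigr => k _.
  by rewrite -big_distrr /=; congr (_ * _)%N; rewrite -sum1_count [RHS]big_mkcond.
by rewrite -sum1_count [RHS]big_mkcond.
Qed.

Definition odds4123_spec n := forall a b, all (leq 1) (a :: b) ->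
  (count (suffix (a :: b)) (odds4123 n))%:R = lamw n (a :: b) 0 0.

Lemma count_evens4123_lamw n k c b : odds4123_spec n -> all (leq 1) (c :: b) ->
  (count_mem [:: k, c & b] (evens4123 n))%:R = bracket (lamw n (c :: b)) k 0 0.
Proof.
case: c => [|p] // hn; rewrite [all _ _]/= => hb; case: k => [|q].
  rewrite br0 (_ : count_mem _ _ = 0%N) //; apply/eqP; rewrite -leqn0 leqNgt -has_count.
  by apply/hasPn => u /evens4123_bounded /andP[_ /andP[hu _]]; apply/eqP => e; rewrite e in hu.
rewrite -lamw_split count_evens4123 natrD hn //; congr (_ + _).
case: ifP => [/andP[h1 h2]|_]; last by rewrite mul0n.
by rewrite mul1n hn //= h1 h2.
Qed.

Lemma count_evens4123_singleton n k : count_mem [:: k] (evens4123 n) = 0%N.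
Proof.
apply/eqP; rewrite -leqn0 leqNgt -has_count; apply/hasPn => u /evens4123_bounded /andP[].
by case: u => [|x [|y u]] //= _ _; rewrite eqseq_cons andbF.
Qed.

Lemma count_evens4123_zero n k b : count_mem [:: k, 0%N & b] (evens4123 n) = 0%N.
Proof.
apply/eqP; rewrite -leqn0 leqNgt -has_count.
apply/hasPn => u /evens4123_bounded /andP[_ /andP[hu _]]; apply/eqP => e.
by move: hu; rewrite e /= andbF.
Qed.

Lemma odds4123_spec0 : odds4123_spec 0.
Proof.
move=> a b /andP[ha hb]; rewrite [count _ _]/= addn0 suffix_cons_eq suffixs0 addn0.
case: b hb => [|c b] hb; first by case: a ha => [|[|a]] // _; rewrite /= lam0r.
(* A second letter forces an exponent of y at least 2, a third one an exponent of x at least 2;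
   [lam 0] vanishes on both. *)
rewrite lamw_cons eqseq_cons andbF; apply/esym; rewrite /bracket big1 // => t _.
case: b hb => [|d b] hb; last by apply: lamw_long => /=; lia.
by rewrite /= lam0r //; move: hb; rewrite /= andbT; lia.
Qed.

Lemma sum_leq_br f q N K : (forall k, (N <= k)%N -> bracket f k 0 0 = 0) -> (N <= q + K)%N ->
  \sum_(k < N) (q < k)%:R * bracket f k 0 0 = \sum_(k < K) bracket f (q + k).+1 0 0.
Proof.
move=> h hNK.
have hK M : (N <= M)%N -> \sum_(k < N) (q < k)%:R * bracket f k 0 0 =
   \sum_(k < M) (q < k)%:R * bracket f k 0 0.
  move=> hM; rewrite !(big_ord_widen _ (fun k => (q < k)%:R * bracket f k 0 0) hM).
  rewrite big_mkcond /=; apply: eq_bigr => k _; case: ifP => // /negbT.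
  by rewrite -leqNgt => /h ->; rewrite mulr0.
rewrite (hK (q.+1 + K)%N); last by lia.
rewrite big_split_ord /= big1 ?add0r; last first.
  by move=> k _; rewrite ltnNge -ltnS ltn_ord mul0r.
by apply: eq_bigr => k _; rewrite addSn ltnS leq_addr mul1r.
Qed.

Lemma odds4123_specS n : odds4123_spec n -> odds4123_spec n.+1.
Proof.
move=> hn; apply: (@count_suffix_unique _ (n.*2 + 6) (fun b => lamw n.+1 b 0 0)).
- move=> w /odds4123_bounded /andP[_ /andP[h1 h2]]; rewrite /bounded h1 /=.
  by apply: leq_trans h2 _; lia.
- by move=> a b _; rewrite lamw_cons br0.
- by move=> b hb; apply: lamw_long; lia.
case=> [|q] [|c b] // h.
  rewrite (@lamw_unfold1 n q (n.*2 + 6)); last by lia.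
  congr (_ + _); rewrite count_odds4123S.
  rewrite [X in _ = (X + _)%N%:R]big1 ?add0n; last by move=> k _; rewrite count_evens4123_singleton muln0.
  case: q {h} => [|q].
    by rewrite /= [X in _ = X%:R]big1 // => k _; rewrite count_evens4123_zero.
  rewrite natr_sum ?ifT //; under [RHS]eq_bigr => k _ do rewrite count_evens4123_lamw //.
  have h0 k i v : (n.*2.+3 < k + i + v)%N -> bracket (lamw n [:: q.+1]) k i v = 0.
    exact: br_lamw0.
  move: (lamw n [:: q.+1]) h0 => f h0.
  rewrite -[LHS](@sum_leq_br _ 0 (n.*2 + 6)); [|by move=> k hk; apply: h0; lia|by lia].
  rewrite (_ : n.*2 + 6 = (n.*2 + 4) + 2)%N; last by lia.
  rewrite doubleS (_ : n.*2.+2.+2 = n.*2 + 4)%N; last by lia.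
  rewrite big_split_ord /= [X in _ + X]big1 ?addr0.
    by apply: eq_bigr => -[[|k] hk] _ /=; rewrite ?mul1r // br0 mulr0.
  by move=> k _; rewrite h0 ?mulr0 //; lia.
rewrite (@lamw_unfold2 n q.+1 c b (n.*2 + 6)); last by lia.
congr (_ + _); rewrite count_odds4123S natrD !natr_sum.
have hcb : all (leq 1) (c :: b) by have /andP[] := h.
have e2 k : (count_mem [:: k, q, c & b] (evens4123 n))%:R =
            bracket (bracket (lamw n (c :: b)) q) k 1 1.
  case: q {h} => [|q].
    by rewrite count_evens4123_zero /bracket big1 // => t _; rewrite big_ord0.
  by rewrite count_evens4123_lamw // -br_shift.
under [X in _ = X + _]eq_bigr => k _ do rewrite natrM count_evens4123_lamw //.
under [X in _ = _ + X]eq_bigr => k _ do rewrite e2.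
have h1 k i v : (n.*2.+3 < k + i + v)%N -> bracket (lamw n (c :: b)) k i v = 0.
  exact: br_lamw0.
have h2 a k i v : (n.*2 + 4 < a + k + i + v)%N ->
   bracket (bracket (lamw n (c :: b)) a) k i v = 0.
  exact: brbr_lamw0.
move: (lamw n (c :: b)) h1 h2 => f h1 h2 {e2}.
(* Expanding [q + 1] [k + 1] as [q + k + 1] + x y [q] [k] separates the two sources found in
   [count_odds4123S]. *)
under [LHS]eq_bigr => k _ do rewrite -br_mul.
rewrite big_split /=; congr (_ + _).
  rewrite -(@sum_leq_br _ q (n.+1.*2.+2)) //; last by lia.
  by move=> k hk; apply: h1; lia.
rewrite (_ : n.*2 + 6 = (n.+1.*2.+2) + 2)%N; last by lia.
rewrite big_split_ord /= [X in _ + X]big1 ?addr0 //.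
by move=> k _; rewrite h2 //; lia.
Qed.

Lemma count_suffix_odds4123 n : odds4123_spec n.
Proof. elim: n => [|n]; [exact: odds4123_spec0 | exact: odds4123_specS]. Qed.

(** The list codes words of length 2n + 2, hence the index n + 1. The recurrence identifies suffix
    counts with [lamv], which is then summed over the bottom letter. *)
Lemma size_evens4123 n : (size (evens4123 n))%:R = lam n.+1 0 1.
Proof.
have hs w : w \in evens4123 n -> bounded (n.*2 + 6) w.
  move=> /evens4123_bounded /andP[_ /andP[h1 h2]]; rewrite /bounded h1 /=.
  by apply: leq_trans h2 _; lia.
have h := @count_suffix_unique (evens4123 n) (n.*2 + 6) (lamv n.+1) hs.
have {}h a : (count (suffix [:: a.+1]) (evens4123 n))%:R = lamv n.+1 [:: a.+1].
  apply: h => //.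
  - by move=> x b _; rewrite /lamv !lamw_cons !br0; ring.
  - by move=> b hb; rewrite /lamv !lamw_long; [ring|lia..].
  move=> [|x] b // hb; rewrite (@lamv_unfold n x b (n.*2 + 6)); last by lia.
  congr (_ + _); case: b hb => [|c b] hb; first by rewrite count_evens4123_singleton.
  by rewrite count_evens4123_lamw //; exact: count_suffix_odds4123.
rewrite -(@sum_lamv n.+1 (n.*2 + 6)); last by lia.
under eq_bigr => a _ do rewrite -h.
rewrite -natr_sum; congr (_%:R); rewrite -count_predT.
under eq_bigr => a _ do rewrite -sum1_count big_mkcond /=.
rewrite exchange_big /= -sum1_count !big_seq /=; apply: eq_bigr => w hw.
(* A nonempty stack has exactly one bottom letter, here between 1 and 2n + 5. *)
have := suffix_unfold [::] (mem_bounded (hs w hw)).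
rewrite suffix0s; have /andP[] := evens4123_bounded hw; case: w hw => [|x w] // hw _ _.
rewrite add0n (_ : n.*2 + 6 = (n.*2 + 5).+1)%N; last by lia.
rewrite big_ord_recl /= => e; rewrite [LHS]e {e}.
have -> : suffix [:: 0%N] (x :: w) = false.
  apply/negP => /suffixP[u e]; have /andP[hp _] := hs _ hw; move: hp.
  by rewrite e all_cat /= andbF.
rewrite add0n [RHS]big_ord_recr /=.
have -> : suffix [:: (n.*2 + 5).+1] (x :: w) = false.
  apply/negP => /suffix1s hx; have /allP/(_ _ hx) := mem_bounded (hs _ hw).
  by rewrite /=; lia.
by rewrite addn0; apply: eq_bigr => k _; rewrite /bump leq0n.
Qed.

(** * Pairs for 1234 *)

Local Close Scope ring_scope.
(* For a word of length m, the state (a, b) stands for the pair (m + 1 - a, m + 1 - b) of the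
   header: v lies below an ascending pair (resp. a 123) if and only if v < a (resp. v < b). *)
Definition pair_up m (st : nat * nat) (y : nat) : nat * nat * nat :=
  (if y == m then st.1 else y.+1, st.2, y).

(** A letter x at or above a starts an ascending pair but no 123; a letter below a starts a 123 and
    shifts a. *)
Definition pair_down (o : nat * nat * nat) (x : nat) : nat * nat :=
  if o.1.1 <= x then (x.+1, o.1.2) else (o.1.1.+1, x.+1).

Definition pair_ups m st := [seq pair_up m st y | y <- iota st.1 (m.+1 - st.1)].
Definition pair_downs o := [seq pair_down o x | x <- iota o.1.2 (o.2.+1 - o.1.2)].

Fixpoint evens1234 (n : nat) : seq (nat * nat) :=
  if n is n'.+1 then
    flatten (map pair_downs (flatten (map (pair_ups n'.*2) (evens1234 n'))))
  else [:: (0, 0)].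

Definition pair_children m st := flatten (map pair_downs (pair_ups m st)).

Lemma evens1234S n :
  evens1234 n.+1 = flatten (map (pair_children n.*2) (evens1234 n)).
Proof.
rewrite /=; elim: (evens1234 n) => //= st s <-.
by rewrite map_cat flatten_cat.
Qed.

Lemma count_iota1 (P : pred nat) (c : bool) z s l :
  (forall x, P x = c && (x == z)) -> count P (iota s l) = c && (s <= z < s + l).
Proof.
move=> h; rewrite (eq_count h); case: c {h} => /=; last by rewrite count_pred0.
by rewrite count_uniq_mem ?iota_uniq // mem_iota.
Qed.

(** The three families are y < m, then y = m with x < a, and y = m with x >= a. *)
Lemma childrenE m a b : b <= a <= m -> pair_children m (a, b) =
  flatten [seq [seq (y.+2, x.+1) | x <- iota b (y.+1 - b)] | y <- iota a (m - a)] ++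
  [seq (a.+1, x.+1) | x <- iota b (a - b)] ++ [seq (x.+1, b) | x <- iota a (m.+1 - a)].
Proof.
move=> hab; rewrite /pair_children /pair_ups /= [in LHS](_ : m.+1 - a = m - a + 1); last by lia.
rewrite iotaD !map_cat flatten_cat /= cats0; congr (_ ++ _).
  rewrite -map_comp; congr flatten; apply/eq_in_map => y; rewrite mem_iota => hy.
  rewrite /= /pair_up /pair_downs /= ifF; last by lia.
  apply/eq_in_map => x; rewrite mem_iota => hx; rewrite /pair_down /= ifF //; lia.
rewrite subnKC; last by lia.
rewrite /pair_up eqxx /pair_downs /=.
rewrite (_ : m.+1 - b = (a - b) + (m - a + 1)); last by lia.
rewrite iotaD map_cat subnKC; last by lia.
rewrite (_ : m - a + 1 = m.+1 - a); last by lia.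
congr (_ ++ _); apply/eq_in_map => x; rewrite mem_iota => hx; rewrite /pair_down /=.
  by rewrite ifF //; lia.
by rewrite ifT //; lia.
Qed.

(** The families of [childrenE] cover, once each, the pairs with a' >= a + 2 and b' > b, those with
    a' = a + 1 and b' > b, and those with b' = b. *)
Lemma count_children m a b a' b' : b <= a <= m ->
  count_mem (a', b') (pair_children m (a, b)) = [&& a < a' <= m.+1, b <= b' & b' < a'].
Proof.
move=> hab; rewrite childrenE // !count_cat !count_map.
have -> : count (preim (fun x => (a.+1, x.+1)) (pred1 (a', b'))) (iota b (a - b)) =
    ((a.+1 == a') && (0 < b')) && (b <= b'.-1 < b + (a - b)).
  by apply: count_iota1 => x /=; rewrite xpair_eqE; case: (b') => [|c] /=; lia.
have -> : count (preim (fun x => (x.+1, b)) (pred1 (a', b'))) (iota a (m.+1 - a)) =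
    ((b == b') && (0 < a')) && (a <= a'.-1 < a + (m.+1 - a)).
  by apply: count_iota1 => x /=; rewrite xpair_eqE; case: (a') => [|c] /=; lia.
rewrite count_flatten sumnE !big_map.
have -> : \sum_(y <- iota a (m - a))
    count_mem (a', b') [seq (y.+2, x.+1) | x <- iota b (y.+1 - b)] =
    count (fun y => [&& y.+2 == a', 0 < b', b < b' & b' < a']) (iota a (m - a)).
  rewrite -sum1_count [RHS]big_mkcond; apply: eq_bigr => y _; rewrite count_map.
  rewrite (@count_iota1 _ ((y.+2 == a') && (0 < b')) b'.-1).
    by rewrite -/(nat_of_bool _); congr nat_of_bool; lia.
  by move=> x /=; rewrite xpair_eqE; case: (b') => [|c] /=; lia.
rewrite (@count_iota1 _ [&& 1 < a', 0 < b', b < b' & b' < a'] a'.-2); last by move=> y; lia.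
case: (ltnP a a') => h1; last by lia.
case: (leqP a' m.+1) => h2; last by lia.
case: (ltngtP b b') => h3; lia.
Qed.

Lemma evens1234_bound n st : st \in evens1234 n -> st.2 <= st.1 <= n.*2.
Proof.
elim: n st => [|n IH] [a' b']; first by rewrite inE => /eqP[-> ->].
rewrite evens1234S => /flattenP[_ /mapP[[a b] /IH /= hab ->]].
rewrite -has_pred1 has_count count_children //; lia.
Qed.

Lemma count_evens1234S n a' b' :
  count_mem (a', b') (evens1234 n.+1) =
  ((b' < a') && (a' <= n.*2.+1)) *
  count (fun st => (st.1 < a') && (st.2 <= b')) (evens1234 n).
Proof.
rewrite evens1234S count_flatten sumnE !big_map big_seq -sum1_count big_distrr /=.
rewrite [RHS]big_mkcond [RHS]big_seq; apply: eq_bigr => -[a b] /evens1234_bound /= h.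
by rewrite count_children //; case: ifP; lia.
Qed.

Local Open Scope ring_scope.

Lemma count_below_lams n a' b' : (b' < a' <= n.*2.+1)%N ->
  (count (fun st => (st.1 < a')%N && (st.2 <= b')%N) (evens1234 n))%:R =
  lams n (a' - b').-1 0 (n.*2.+2 - a').
Proof.
elim: n a' b' => [|n IH] a' b' h.
  have ha : (a' = 1)%N by lia.
  have hb : (b' = 0)%N by lia.
  by rewrite ha hb.
set s := evens1234 n.+1.
(* With the second component fixed at c, the first one runs over a' - 1 - r, and each multiplicity
   is a count one level down. *)
have hd c : (c < a')%N ->
    (count (fun st => (st.1 < a')%N && (st.2 == c)) s)%:R =
    \sum_(r < (a' - c).-1) lams n ((a' - c).-2 - r) 0 (n.*2.+3 - a' + r).
  move=> hc.
  transitivity (\sum_(r < (a' - c).-1) (count_mem ((a'.-1 - r)%N, c) s)%:R : rat).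
    rewrite -natr_sum; congr (_%:R); rewrite -sum1_count big_mkcond /=.
    under [RHS]eq_bigr => r _ do rewrite -sum1_count big_mkcond.
    rewrite exchange_big /= !big_seq; apply: eq_bigr => -[a b] hab /=.
    have hba : (b < a)%N.
      move: hab; rewrite -has_pred1 has_count count_evens1234S.
      by case: (b < a)%N.
    case: ifP => [/andP[h1 /eqP hbc]|hn]; last first.
      rewrite big1 // => r _; rewrite xpair_eqE; case: ifP => // /andP[/eqP h1 /eqP h2].
      by move: hn; rewrite h2 eqxx andbT; have := ltn_ord r; lia.
    have hr : (a'.-1 - a < (a' - c).-1)%N by lia.
    rewrite (bigD1 (Ordinal hr)) //= xpair_eqE hbc eqxx andbT ifT; last by lia.
    rewrite big1 // => r; rewrite -val_eqE /= xpair_eqE => hne.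
    by rewrite ifF //; have := ltn_ord r; lia.
  apply: eq_bigr => r _; have hr := ltn_ord r; rewrite count_evens1234S natrM.
  (* The exceptional case is a' = 2n + 3 with r = 0; the exponent of y is then 0 and antisymmetry
     kills the term. *)
  case: (leqP (a'.-1 - r) n.*2.+1) => ha; last first.
    rewrite andbF mul0r (_ : n.*2.+3 - a' + r = 0)%N ?lams_diag //; lia.
  rewrite IH; last by lia.
  rewrite (_ : (c < a'.-1 - r)%N); last by lia.
  by rewrite mul1r; congr lams; lia.
have hv : (n.+1.*2.+2 - a' = (n.*2.+3 - a').+1)%N by lia.
(* As differences, the counts for fixed c telescope over c <= b'; at c = 0 the subtracted term
   vanishes by degree. *)
have {}hd c : (c < a')%N ->
    (count (fun st => (st.1 < a')%N && (st.2 == c)) s)%:R =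
    lams n.+1 (a' - c).-1 0 (n.+1.*2.+2 - a') - lams n.+1 (a' - c) 0 (n.+1.*2.+2 - a').
  move=> hc; rewrite hd // hv.
  have := lams_rec0 n (a' - c).-1 (n.*2.+3 - a').
  by rewrite (_ : (a' - c).-1.+1 = (a' - c)%N) => [<-|] //; lia.
have hc0 : lams n.+1 a' 0 (n.+1.*2.+2 - a') = 0 by apply: lams0; lia.
have hb : (b' < a')%N by lia.
elim: b' hb {h} => [|b IHb] hb.
  under eq_count do rewrite leqn0.
  by rewrite hd // subn0 hc0 subr0.
have -> : count (fun st => (st.1 < a')%N && (st.2 <= b.+1)%N) s =
  (count (fun st => (st.1 < a')%N && (st.2 <= b)%N) s +
   count (fun st => (st.1 < a')%N && (st.2 == b.+1)) s)%N.
  rewrite -!sum1_count [RHS](_ : _ = \sum_(st <- s) (((st.1 < a') && (st.2 <= b)) +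
     ((st.1 < a') && (st.2 == b.+1))))%N.
    by rewrite big_mkcond; apply: eq_bigr => st _; case: ifP; lia.
  by rewrite [RHS]big_split /=; congr (_ + _)%N; rewrite [LHS]big_mkcond.
rewrite natrD IHb ?hd; [|lia..].
rewrite (_ : (a' - b).-1 = (a' - b.+1)%N); last by lia.
by rewrite addrCA subrr addr0.
Qed.

Lemma size_evens1234 n : (size (evens1234 n))%:R = lam n 0 1.
Proof.
have := @count_below_lams n n.*2.+1 n.*2.
rewrite (_ : (n.*2.+1 - n.*2).-1 = 0)%N; last by lia.
rewrite (_ : n.*2.+2 - n.*2.+1 = 1)%N /=; last by lia.
move=> <- //; last by lia.
rewrite -count_predT; congr (_%:R); apply: eq_in_count => st /evens1234_bound /=; lia.
Qed.

(** * Permutations as words *)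

Local Close Scope ring_scope.
Definition ins (v : nat) (s : seq nat) : seq nat := v :: map (bump v) s.

(* Letters are 0-based, as in the definition of UD. *)
Fixpoint words (m : nat) : seq (seq nat) :=
  if m is m'.+1 then [seq ins v s | s <- words m', v <- iota 0 m] else [:: [::]].

Definition is_word m s := [&& uniq s, size s == m & all (ltn^~ m) s].

Lemma is_word_ins m v s : v <= m -> is_word m s -> is_word m.+1 (ins v s).
Proof.
move=> hv /and3P[us /eqP ss hs]; apply/and3P; split=> /=; last 1 first.
- rewrite ltnS hv all_map /=; apply/allP => x /(allP hs) /= hx.
  by rewrite /bump; lia.
- rewrite map_inj_uniq ?us ?andbT; last exact: (can_inj (bumpK v)).
  by apply/mapP => -[x _ e]; have := neq_bump v x; rewrite -e eqxx.
by rewrite size_map ss.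
Qed.

Lemma mem_words m s : s \in words m -> is_word m s.
Proof.
elim: m s => [|m IH] s; first by rewrite inE => /eqP ->.
move=> /allpairsPdep[s' [v [/IH hs']]]; rewrite mem_iota => /= hv ->.
exact: is_word_ins.
Qed.

Lemma is_word_mem m s x : is_word m s -> (x \in s) = (x < m).
Proof.
move=> /and3P[us /eqP ss /allP hs].
have hsub : {subset s <= iota 0 m} by move=> y /hs; rewrite mem_iota.
have hle : size (iota 0 m) <= size s by rewrite size_iota ss.
have [_ ->] := uniq_min_size us hsub hle.
by rewrite mem_iota.
Qed.

Lemma uniq_words m : uniq (words m).
Proof.
elim: m => // m IH; rewrite -/(uniq [seq ins v s | s <- words m, v <- iota 0 m.+1]).
apply: (@allpairs_uniq _ _ _ (fun s v => ins v s)) => //; first exact: iota_uniq.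
move=> [s v] [s' v'] _ _ /= [-> e]; congr pair.
by apply: inj_map e; apply: can_inj (bumpK v').
Qed.

Lemma size_words m : size (words m) = m`!.
Proof.
elim: m => // m IH.
by rewrite (size_allpairs (fun s v => ins v s)) IH size_iota factS mulnC.
Qed.

(** * Words of permutations *)

Definition word m (p : 'S_m) : seq nat := [seq val (p i) | i <- enum 'I_m].

Lemma size_word m (p : 'S_m) : size (word p) = m.
Proof. by rewrite size_map size_enum_ord. Qed.

Lemma nth_word m (p : 'S_m) (i : 'I_m) : nth 0 (word p) i = p i.
Proof. by rewrite (nth_map i) ?size_enum_ord // nth_ord_enum. Qed.

Lemma word_inj m : injective (@word m).
Proof.
move=> p q e; apply/permP => i; apply: val_inj.
by rewrite /= -!nth_word e.
Qed.

Lemma wordK m s : is_word m s -> exists p : 'S_m, word p = s.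
Proof.
move=> /and3P[us /eqP ss hs].
have hn (i : 'I_m) : nth 0 s i < m by apply: (allP hs); rewrite mem_nth // ss.
have hinj : injective (fun i => Ordinal (hn i)).
  move=> i j /(congr1 val) /= /eqP; rewrite nth_uniq ?ss // => /eqP; exact: val_inj.
exists (perm hinj); apply: (@eq_from_nth _ 0) => [|i]; rewrite size_word ?ss // => hi.
by rewrite (nth_word (perm hinj) (Ordinal hi)) permE.
Qed.

(** Every listed word comes from a permutation, and both lists are duplicate-free with m!
    entries. *)
Lemma perm_words m : perm_eq (map (@word m) (enum 'S_m)) (words m).
Proof.
have um : uniq (map (@word m) (enum 'S_m)).
  by rewrite map_inj_uniq ?enum_uniq //; exact: word_inj.
rewrite perm_sym; apply: uniq_perm (uniq_words m) um _.
have hsub : {subset words m <= map (@word m) (enum 'S_m)}.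
  by move=> s /mem_words /wordK[p <-]; apply: map_f; rewrite mem_enum.
apply: (uniq_min_size (uniq_words m) hsub _).2.
by rewrite size_map -cardE card_Sn size_words.
Qed.

Lemma card_words m (P : pred 'S_m) (good : pred (seq nat)) :
  (forall p, P p = good (word p)) -> #|[set p | P p]| = count good (words m).
Proof.
move=> h; rewrite cardsE -(seq.permP (perm_words m)) count_map cardE size_filter.
rewrite -enumT; apply: eq_count => p; exact: h.
Qed.

(* Some increasing subsequence of length k has all its letters in [l, t). *)
Fixpoint inc (k l t : nat) (s : seq nat) : bool :=
  if s is x :: s' then
    (if k is k'.+1 then (l <= x < t) && inc k' x.+1 t s' else true) || inc k l t s'
  else k == 0.

Lemma inc0 l t s : inc 0 l t s.
Proof. by elim: s. Qed.

Lemma unbump_leq v l x : (l <= bump v x) = (unbump v l <= x).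
Proof. by rewrite /bump /unbump; lia. Qed.

Lemma unbump_gt v t x : (bump v x < t) = (x < unbump v t).
Proof. by rewrite /bump /unbump; lia. Qed.

Lemma inc_bump k l t v s :
  inc k l t (map (bump v) s) = inc k (unbump v l) (unbump v t) s.
Proof.
elim: s k l => [|x s IH] [|k] l //=; rewrite !IH unbump_leq unbump_gt.
by congr (_ && inc _ _ _ _ || _); rewrite /bump /unbump; lia.
Qed.

Lemma inc_ins k l t v s :
  inc k.+1 l t (ins v s) =
  (l <= v < t) && inc k v (unbump v t) s || inc k.+1 (unbump v l) (unbump v t) s.
Proof.
rewrite /ins /= !inc_bump; congr (_ && inc _ _ _ _ || _).
by rewrite /unbump; lia.
Qed.

Lemma inc1 m l t s : is_word m s -> inc 1 l t s = (l < t) && (l < m).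
Proof.
move=> hs; have -> : inc 1 l t s = has (fun x => l <= x < t) s.
  by elim: s {hs} => //= x s ->; rewrite inc0 andbT.
apply/hasP/andP => [[x]|[h1 h2]].
  by rewrite (is_word_mem _ hs) => h; lia.
by exists l; rewrite ?(is_word_mem _ hs) //; lia.
Qed.

Lemma incP k l t s :
  reflect (exists r, [&& subseq r s, size r == k, sorted ltn r & all (fun x => l <= x < t) r])
          (inc k l t s).
Proof.
elim: s k l => [|x s IH] [|k] l /=.
- by apply: ReflectT; exists [::].
- by apply: ReflectF => -[[|y r]].
- by apply: ReflectT; exists [::].
apply: (iffP orP) => [[/andP[hx /IH[r /and4P[h1 /eqP h2 h3 h4]]]|/IH[r /and4P[h1 h2 h3 h4]]]|].
- exists (x :: r); rewrite /= eqxx h1 h2 eqxx hx path_sortedE ?h3 /=; last exact: ltn_trans.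
  rewrite andbT; apply/andP; split; first by apply: sub_all h4 => y /=; lia.
  by apply: sub_all h4 => y /=; lia.
- exists r; rewrite h2 h3 h4 !andbT.
  exact: subseq_trans h1 (subseq_cons _ _).
case=> -[|y r] //= /and4P[]; case: eqP => [->|_] h1 h2.
  rewrite path_sortedE; last exact: ltn_trans.
  move=> /andP[h3 h4] /andP[h5 h6]; left; rewrite h5; apply/IH; exists r.
  rewrite h1 h4 -eqSS h2 /=; apply/allP => z hz.
  by have := allP h3 z hz; have := allP h6 z hz; rewrite /=; lia.
by move=> h3 h4; right; apply/IH; exists (y :: r); rewrite h1 h2 /= h3 h4.
Qed.

Fixpoint has4123 (s : seq nat) : bool :=
  if s is x :: s' then inc 3 0 x s' || has4123 s' else false.

Lemma has4123_bump v s : has4123 (map (bump v) s) = has4123 s.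
Proof. by elim: s => //= x s ->; rewrite inc_bump bumpK. Qed.

Lemma has4123P s :
  reflect (exists x r, [&& subseq (x :: r) s, size r == 3, sorted ltn r & all (ltn^~ x) r])
          (has4123 s).
Proof.
elim: s => [|y s IH] /=; first by apply: ReflectF => -[x [r]].
apply: (iffP orP) => [[/incP[r /and4P[h1 h2 h3 h4]]|/IH[x [r /and4P[h1 h2 h3 h4]]]]|].
- by exists y, r; rewrite /= eqxx h1 h2 h3.
- by exists x, r; rewrite h2 h3 h4 !andbT; exact: subseq_trans h1 (subseq_cons _ _).
case=> x [r /and4P[]]; rewrite /=; case: eqP => [->|_] h1 h2 h3 h4.
  by left; apply/incP; exists r; rewrite h1 h2 h3.
by right; apply/IH; exists x, r; rewrite h1 h2 h3.
Qed.

Lemma containsP m (p : 'S_m) tau :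
  reflect (exists r, [/\ subseq r (word p), size r = size tau &
     forall a b, a < size tau -> b < size tau ->
       (nth 0 r a < nth 0 r b) = (nth 0 tau a < nth 0 tau b)])
  (contains p tau).
Proof.
have hen : sorted (fun i j : 'I_m => i < j) (enum 'I_m).
  by have := iota_ltn_sorted 0 m; rewrite -val_enum_ord sorted_map.
have tr : transitive (fun i j : 'I_m => i < j) by move=> i j k; apply: ltn_trans.
apply: (iffP existsP) => [[f /andP[/forallP h1 /forallP h2]]|[r [h1 h2 h3]]].
  set il := [seq f a | a <- enum 'I_(size tau)].
  have sil : size il = size tau by rewrite size_map size_enum_ord.
  exists [seq val (p i) | i <- il]; split; last 1 first.
  - move=> a b ha hb; have /forallP/(_ (Ordinal hb))/eqP := h2 (Ordinal ha).
    move=> /= <-; have ni c (hc : c < size tau) : nth 0 [seq val (p i) | i <- il] c =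
       p (f (Ordinal hc)).
      rewrite -map_comp (nth_map (Ordinal hc)) ?size_enum_ord //=.
      by rewrite (nth_ord_enum (Ordinal hc) (Ordinal hc)).
    by rewrite !ni.
  (* [il] is increasing, so it is the sublist of [enum 'I_m] selected by membership. *)
  - apply: map_subseq; have -> : il = filter (mem il) (enum 'I_m).
      apply: (@irr_sorted_eq _ (fun i j : 'I_m => i < j)) => //.
      + by move=> i; rewrite /= ltnn.
      + rewrite sorted_map; have := iota_ltn_sorted 0 (size tau).
        rewrite -val_enum_ord sorted_map; apply: sub_sorted => a b /= hab.
        by have /forallP/(_ b)/implyP := h1 a; apply.
      + exact: sorted_filter.
      by move=> i; rewrite mem_filter mem_enum andbT.
    exact: filter_subseq.
  by rewrite size_map.
have /subseqP[b sb er] := h1.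
set il := mask b (enum 'I_m); have eri : r = [seq val (p i) | i <- il].
  by rewrite er /word map_mask.
have sil : size tau = size il by rewrite -h2 eri size_map.
have ois : sorted (fun i j : 'I_m => i < j) il by apply: sorted_mask.
exists [ffun a => tnth (in_tuple il) (cast_ord sil a)].
apply/andP; split; apply/forallP => a; apply/forallP => c; rewrite !ffunE.
  have [i0 _] : exists i0 : 'I_m, True by exists (tnth (in_tuple il) (cast_ord sil a)).
  apply/implyP => hac; rewrite !(tnth_nth i0) /=.
  by apply: (sorted_ltn_nth tr) => //=; rewrite inE -sil.
have [i0 _] : exists i0 : 'I_m, True by exists (tnth (in_tuple il) (cast_ord sil a)).
by apply/eqP; rewrite -h3 // eri !(nth_map i0) -?sil // !(tnth_nth i0).
Qed.

Lemma contains1234 m (p : 'S_m) : contains p [:: 1; 2; 3; 4] = inc 4 0 m (word p).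
Proof.
apply/containsP/incP => [[r [h1 h2 h3]]|[r /and4P[h1 /eqP h2 h3 h4]]]; exists r.
  rewrite h1 h2 eqxx /=; apply/andP; split; last first.
    by apply/allP => x /(mem_subseq h1) /mapP[i _ ->] /=.
  case: r h2 h3 {h1} => [|a [|b [|c [|d []]]]] //= _ h3.
  by rewrite (h3 0 1) // (h3 1 2) // (h3 2 3).
split=> //; case: r h2 h3 {h1 h4} => [|a [|b [|c [|d []]]]] //= _.
move=> /and4P[hab hbc hcd _] [|[|[|[|i]]]] [|[|[|[|j]]]] //= _ _; lia.
Qed.

Lemma contains4123 m (p : 'S_m) : contains p [:: 4; 1; 2; 3] = has4123 (word p).
Proof.
apply/containsP/has4123P => [[r [h1 h2 h3]]|[x [r /and4P[h1 /eqP h2 h3 h4]]]].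
  case: r h1 h2 h3 => [|a [|b [|c [|d []]]]] //= h1 _ h3.
  exists a, [:: b; c; d]; rewrite h1 /=.
  by rewrite (h3 1 2) // (h3 2 3) // (h3 1 0) // (h3 2 0) // (h3 3 0).
exists (x :: r); split=> //=; first by rewrite h2.
case: r h2 h3 h4 {h1} => [|b [|c [|d []]]] //= _.
move=> /and3P[hbc hcd _] /and4P[hb hc hd _].
move=> [|[|[|[|i]]]] [|[|[|[|j]]]] //= _ _; lia.
Qed.

(* The letters alternate so that an even-length word starts with an ascent. *)
Fixpoint alt (s : seq nat) : bool :=
  if s is x :: s' then
    (if s' is y :: _ then (if odd (size s') then x < y else y < x) else true) && alt s'
  else true.

Lemma altP s : reflect (forall i, i.+1 < size s ->
    if odd (size s - i.+1) then nth 0 s i < nth 0 s i.+1 else nth 0 s i.+1 < nth 0 s i)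
  (alt s).
Proof.
elim: s => [|x s IH] /=; first exact: ReflectT.
apply: (iffP andP) => [[h1 /IH h2] [|i] hi|h].
- by rewrite subn1; case: s h1 {IH h2} hi.
- by rewrite subSS; apply: h2.
split; last by apply/IH => i hi; have := h i.+1 hi; rewrite subSS.
by case: s h {IH} => [|y s] // /(_ 0 isT); rewrite subn1.
Qed.

Lemma alt_bump v s : alt (map (bump v) s) = alt s.
Proof.
elim: s => //= x s ->; congr (_ && _); case: s => //= y s; rewrite size_map.
by case: ifP => _; rewrite /bump; lia.
Qed.

(** [alt] takes parities from the right end, which for even m agree with those of the positions. *)
Lemma updown_alt m (p : 'S_m) : ~~ odd m -> updown p = alt (word p).
Proof.
move=> hm.
have ho i : i.+1 < m -> odd (m - i.+1) = ~~ odd i.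
  by move=> hi; rewrite oddB 1?ltnW // (negbTE hm).
apply/forallP/altP => [h i|h i].
  rewrite size_word => hi; have /forallP/(_ (Ordinal hi)) := h (Ordinal (ltnW hi)).
  by rewrite /= eqxx /= -!nth_word /= ho //; case: (odd i).
apply/forallP => j; apply/implyP => /eqP e.
have {}e : nat_of_ord j = i.+1 := e; have hi : i.+1 < m by rewrite -e.
have := h i; rewrite size_word ho // hi => /(_ isT).
by rewrite -e !nth_word; case: (odd i).
Qed.

(** * Coding avoiding words by states *)

Local Close Scope ring_scope.

Section Coding.
Variable good : pred (seq nat).
Hypothesis good_ins : forall m v s, is_word m s -> v <= m -> good (ins v s) -> good s.

Lemma filter_words m : filter good (words m.+1) =
  flatten [seq [seq ins v s | v <- iota 0 m.+1 & good (ins v s)] | s <- words m & good s].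
Proof.
have h s v : s \in words m -> v \in iota 0 m.+1 -> good (ins v s) -> good s.
  by move=> /mem_words hs; rewrite mem_iota => hv; apply: good_ins hs _.
rewrite [words _]/(flatten [seq [seq ins v s | v <- iota 0 m.+1] | s <- words m]).
elim: (words m) h => // s l IH h; rewrite [LHS]filter_cat IH; last first.
  by move=> s' v hs'; apply: h; rewrite inE hs' orbT.
move: (iota 0 m.+1) h => V h; rewrite filter_map [filter good (s :: l)]/=.
case: ifP => //= hs; rewrite (eq_in_filter (a2 := pred0)) ?filter_pred0 // => v hv /=.
by apply/negP => /(h _ _ (mem_head _ _) hv); rewrite hs.
Qed.

(** [G] pairs words and states in list order, with multiplicity, as different words may share a
    state. *)
Definition coded (T : eqType) m (l : seq T) (Inv : seq nat -> T -> Prop) :=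
  exists G : seq (seq nat * T),
  [/\ map fst G = filter good (words m), map snd G = l & forall x, x \in G -> Inv x.1 x.2].

Lemma coded_size (T : eqType) m (l : seq T) Inv : coded m l Inv -> count good (words m) = size l.
Proof. by case=> G [h1 h2 _]; rewrite -size_filter -h1 -h2 !size_map. Qed.

Lemma coded_step (T T' : eqType) m (l : seq T) Inv (Inv' : seq nat -> T' -> Prop) vs nx :
  coded m l Inv ->
  (forall s t, is_word m s -> good s -> Inv s t ->
     [seq v <- iota 0 m.+1 | good (ins v s)] = vs t) ->
  (forall s t v, is_word m s -> good s -> Inv s t -> v <= m -> v \in vs t ->
     good (ins v s) -> Inv' (ins v s) (nx t v)) ->
  coded m.+1 (flatten [seq [seq nx t v | v <- vs t] | t <- l]) Inv'.
Proof.
move=> [G [h1 h2 h3]] hvs hnx.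
have hG x : x \in G -> [/\ is_word m x.1, good x.1 & Inv x.1 x.2].
  move=> hx; have : x.1 \in filter good (words m) by rewrite -h1 map_f.
  by rewrite mem_filter => /andP[hg /mem_words hw]; split=> //; apply: h3.
exists (flatten [seq [seq (ins v x.1, nx x.2 v) | v <- vs x.2] | x <- G]); split.
- rewrite filter_words -h1 -map_comp map_flatten -map_comp; congr flatten.
  apply/eq_in_map => x /hG[hw hg hi]; have := hvs _ _ hw hg hi.
  by move: (iota 0 m.+1) => V e; rewrite /= -map_comp e.
- rewrite -h2 map_flatten -!map_comp; congr flatten.
  by apply/eq_in_map => x _ /=; rewrite -map_comp.
move=> _ /flattenP[_ /mapP[x hx ->] /mapP[v hv ->]] /=.
have [hw hg hi] := hG x hx; have := hv; rewrite -(hvs _ x.2 hw hg hi) mem_filter mem_iota.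
by move=> /andP[hgv /andP[_ hvm]]; apply: hnx.
Qed.
End Coding.

Lemma filter_iota (P : pred nat) m lo len :
  (forall v, v <= m -> P v = (lo <= v < lo + len)) -> lo + len <= m.+1 ->
  filter P (iota 0 m.+1) = iota lo len.
Proof.
move=> h hm; apply: (irr_sorted_eq ltn_trans ltnn).
- exact/sorted_filter/iota_ltn_sorted/ltn_trans.
- exact: iota_ltn_sorted.
move=> v; rewrite mem_filter !mem_iota /= add0n.
by case: (leqP v m) => hv; [rewrite h // ltnS hv andbT|rewrite ltnS leqNgt hv andbF; lia].
Qed.

Lemma alt_ins v s : alt (ins v s) =
  (if s is y :: _ then (if odd (size s) then v <= y else y < v) else true) && alt s.
Proof.
rewrite /ins [LHS]/= alt_bump; congr (_ && _); case: s => //= y s; rewrite size_map.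
by case: ifP => _; rewrite /bump; lia.
Qed.

Lemma size_is_word m s : is_word m s -> size s = m.
Proof. by case/and3P=> _ /eqP. Qed.

(* In an odd-length word, a first letter starting a 123 dooms every extension to the left by
   a smaller letter, so such words are discarded. *)
Definition good1234 (s : seq nat) :=
  [&& alt s, ~~ inc 4 0 (size s) s &
      ~~ (odd (size s) && (if s is y :: s' then inc 2 y.+1 (size s) s' else false))].

Lemma unbump_size v m : v <= m -> unbump v m.+1 = m.
Proof. by rewrite /unbump => h; lia. Qed.

Lemma good1234_ins m v s : is_word m s -> v <= m -> good1234 (ins v s) =
  [&& (if s is y :: _ then (if odd m then v <= y else y < v) else true), alt s,
      ~~ inc 3 v m s, ~~ inc 4 0 m s & odd m || ~~ inc 2 v m s].
Proof.
move=> hs hv; have ss := size_is_word hs.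
have si : size (ins v s) = m.+1 by rewrite /= size_map ss.
have hb : unbump v v.+1 = v by rewrite /unbump; lia.
rewrite /good1234 alt_ins si ss inc_ins unbump_size // [_ <= v < _]/= ltnS hv /=.
rewrite inc_bump hb unbump_size // negb_or negb_and negbK.
by case: (if s is _ :: _ then _ else _); case: (alt s); case: (inc 3 _ _ _) => //=.
Qed.

(** A discarded odd-length word has no good extension: the new letter must go below the first
    letter, whose 123 it completes to a 1234. *)
Lemma good1234_ins_inv m v s : is_word m s -> v <= m -> good1234 (ins v s) -> good1234 s.
Proof.
move=> hs hv; rewrite (good1234_ins hs hv) /good1234 (size_is_word hs).
case/and5P=> h1 -> h3 -> _; rewrite /=; case hm : (odd m) => //=.
case: s hs h1 h3 => // y s hs; rewrite hm => h1 h3; apply/negP => h4; case/negP: h3 => /=.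
rewrite h1 h4 andbT /=; have -> : y < m by rewrite -(is_word_mem _ hs) mem_head.
by [].
Qed.

Definition inv_even1234 m (s : seq nat) (st : nat * nat) :=
  [/\ forall v, inc 2 v m s = (v < st.1), forall v, inc 3 v m s = (v < st.2),
      st.2 <= st.1 <= m & if s is y :: _ then y < st.1 else true].

Definition inv_odd1234 m (s : seq nat) (o : nat * nat * nat) :=
  [/\ forall v, inc 2 v m s = (v < o.1.1), forall v, inc 3 v m s = (v < o.1.2),
      (o.1.2 <= o.2 < m) && (o.1.1 <= m) & if s is y :: _ then y == o.2 else false].

Lemma inc2_ins m u v s : is_word m s -> v <= m ->
  inc 2 u m.+1 (ins v s) = (u <= v) && (v < m) || inc 2 (unbump v u) m s.
Proof.
move=> hs hv; rewrite inc_ins unbump_size // (inc1 _ _ hs) ltnS hv andbT.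
by case: (v < m); rewrite ?andbT.
Qed.

Lemma inc3_ins m u v s : is_word m s -> v <= m ->
  inc 3 u m.+1 (ins v s) = (u <= v) && inc 2 v m s || inc 3 (unbump v u) m s.
Proof. by move=> hs hv; rewrite inc_ins unbump_size // ltnS hv andbT. Qed.

Lemma coded_up1234 m l : ~~ odd m -> coded good1234 m l (inv_even1234 m) ->
  coded good1234 m.+1 (flatten (map (pair_ups m) l)) (inv_odd1234 m.+1).
Proof.
move=> hm hl; apply: (coded_step good1234_ins_inv hl) => s [a b] => [hs hg|v hs hg].
  case=> /= h2 h3 hab hh; apply: filter_iota => [v hv|]; last by lia.
  rewrite (good1234_ins hs hv) h2 h3 (negbTE hm) /=.
  move: hg; rewrite /good1234 (size_is_word hs) => /and3P[-> -> _] /=.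
  by case: s hh {hs h2 h3} => [|y s] hh; lia.
case=> /= h2 h3 hab hh hv; rewrite mem_iota => hav _; split.
(* The letter v = m exceeds all others and starts no ascending pair. *)
- move=> u; rewrite inc2_ins // h2 /=; case: eqP => [->|/eqP hne].
    by rewrite ltnn andbF /unbump /=; lia.
  by rewrite /unbump; lia.
- by move=> u; rewrite inc3_ins // h2 h3 /unbump /=; lia.
- by rewrite /=; case: eqP; lia.
by rewrite /= eqxx.
Qed.

Lemma coded_down1234 m l : odd m -> coded good1234 m l (inv_odd1234 m) ->
  coded good1234 m.+1 (flatten (map pair_downs l)) (inv_even1234 m.+1).
Proof.
move=> hm hl; apply: (coded_step good1234_ins_inv hl) => s [[a b] y] => [hs hg|v hs hg].
  case=> /= h2 h3 hab hh; apply: filter_iota => [v hv|]; last by lia.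
  rewrite (good1234_ins hs hv) h2 h3 hm /=.
  move: hg; rewrite /good1234 (size_is_word hs) => /and3P[-> -> _] /=.
  by case: s hh {hs h2 h3} => [|z s] hh //; lia.
case=> /= h2 h3 hab hh hv; rewrite mem_iota => hav _.
rewrite /pair_down /=; case: leqP => hav'; split; try by rewrite /=; lia.
- by move=> u; rewrite inc2_ins // h2 /unbump /=; lia.
- by move=> u; rewrite inc3_ins // h2 h3 /unbump /=; lia.
- by move=> u; rewrite inc2_ins // h2 /unbump /=; lia.
- by move=> u; rewrite inc3_ins // h2 h3 /unbump /=; lia.
Qed.

Lemma coded_evens1234 n : coded good1234 n.*2 (evens1234 n) (inv_even1234 n.*2).
Proof.
elim: n => [|n IH].
  by exists [:: ([::], (0, 0))]; split => // x; rewrite inE => /eqP ->.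
apply: coded_down1234; first by rewrite /= odd_double.
by apply: coded_up1234; rewrite // odd_double.
Qed.

Lemma card_UD1234 n : #|UD (2 * n) [:: 1; 2; 3; 4]| = size (evens1234 n).
Proof.
rewrite -(coded_size (coded_evens1234 n)) mul2n; apply: card_words => p.
rewrite updown_alt ?odd_double // /avoids contains1234 /good1234 size_word odd_double.
by rewrite andbT.
Qed.

(** * Coding 4123-avoiding words by stacks *)

(** Mirrors [inc 2 l t]: a suffix with top q records the values q - 2, q - 1, which lie in [l, t)
    when l + 2 <= q <= t. *)
Fixpoint reach (w : seq nat) (l t : nat) : bool :=
  if w is a :: w' then (l.+2 <= stack_top w <= t) || reach w' l t else false.

Lemma reach_bound w l t : reach w l t -> l.+2 <= minn t (stack_top w).
Proof.
elim: w => //= a w IH; rewrite top_cons => /orP[|/IH]; lia.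
Qed.

Lemma reach_top w l : l.+2 <= stack_top w -> reach w l (stack_top w).
Proof. by case: w => //= a w ->; rewrite leqnn. Qed.

Lemma reach_minn w l t v : stack_top w <= v -> reach w l t = reach w l (minn t v).
Proof.
elim: w => //= a w IH; rewrite top_cons => h; rewrite IH; last by lia.
by congr (_ || _); lia.
Qed.

Lemma reach_mono w l l' t : l' <= l -> reach w l t -> reach w l' t.
Proof.
move=> hl; elim: w => //= a w IH /orP[h|/IH ->]; last by rewrite orbT.
by apply/orP; left; lia.
Qed.

(** The new least end of a 123 is v + 1 + k, and [w'] records the pair v, v + 1 and the old pairs
    below v. Old pairs above v are dropped, as v turns them into a 123. *)
Lemma stack_splitP w v : all (leq 1) w -> v.+2 <= stack_top w -> exists k w',
  [/\ stack_split w v = k :: w', stack_top w' = v.+2, forall t, reach w v t = (v.+1 + k <= t) &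
      forall l t, reach w' l t = (l <= v) && (v.+2 <= t) || reach w l (minn t v)].
Proof.
elim: w => [|a w IH] //= /andP[ha hw] hv; have ht := top_cons a w.
case: ifP => hvw.
  have [k [w' [-> h1 h2 h3]]] := IH hw hvw; exists k, w'; split => // [t|l t].
    rewrite h2; have := reach_top hvw; rewrite h2 => h.
    by apply/orP/idP => [[]|]; [lia..|right].
  rewrite h3; congr (_ || _); rewrite [_ <= _ <= _](_ : _ = false) //; lia.
have hr t : reach w v t = false.
  by apply/negP => /reach_bound; lia.
case: eqP => hvt.
  case: w hw hvt hv ht hr {IH hvw} => [|c w] /= hw hvt hv ht hr.
    by move: hvt; rewrite /stack_top.
  move: hw => /andP[hc hw]; have ht' := top_cons c w; have hts := top_cons c.+1 w.
  exists a.+1, (c.+1 :: w); split; [by []|by rewrite hts; lia| |].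
    by move=> t; rewrite hr ht; lia.
  move=> l t /=; rewrite (@reach_minn w l t v); last by lia.
  by case: (reach w l (minn t v)); rewrite ?orbT // !orbF; lia.
exists (stack_top (a :: w) + 1 - v.+2), (v.+1 - stack_top w :: w).
have hts := top_cons (v.+1 - stack_top w) w; split; [by []|by rewrite hts; lia| |].
  by move=> t; rewrite hr ht; lia.
move=> l t /=; rewrite (@reach_minn w l t v); last by lia.
by case: (reach w l (minn t v)); rewrite ?orbT // !orbF; lia.
Qed.

Lemma stack_decP k w v : 0 < size w -> all (leq 1) w -> stack_top w <= v.+1 ->
  [/\ stack_top (stack_dec (k :: w) v) = v.+2, forall t, reach w v t = false &
      forall l t, reach (stack_dec (k :: w) v) l t =
        (l <= v) && (v.+2 <= t) || reach w l (minn t v)].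
Proof.
move=> hs hw hv; have hr t : reach w v t = false by apply/negP => /reach_bound; lia.
rewrite /=; case: eqP => hvt.
  case: w hs hw hv hvt hr => [|c w] //= _ /andP[hc hw] hv hvt hr.
  have ht := top_cons c w; have hts := top_cons c.+1 w.
  split; [by rewrite hts; lia|by []|move=> l t].
  rewrite /= (@reach_minn w l t v); last by lia.
  by case: (reach w l (minn t v)); rewrite ?orbT // !orbF; lia.
have hts := top_cons (v.+1 - stack_top w) w; split; [by rewrite hts; lia|by []|move=> l t].
by rewrite /= (@reach_minn w l t v); [congr (_ || _)|]; lia.
Qed.

(* The letters of [w] record the consecutive values x, x+1 (with x = q - 2 for the tops q of
   the suffixes of w) that occur in increasing order below the least end c of a 123. *)
Definition stack_inv m (s w : seq nat) (c : nat) :=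
  [/\ forall l t, t <= c -> inc 2 l t s = reach w l t,
      forall t, t <= m -> inc 3 0 t s = (c < t) & c <= m].

Lemma stack_inv_ins m s w c v w' c1 : is_word m s -> stack_inv m s w c -> v <= c ->
  c1 <= c.+1 -> (forall t, t <= c -> reach w v t = (c1 <= t)) ->
  (forall l t, reach w' l t = (l <= v) && (v.+2 <= t) || reach w l (minn t v)) ->
  stack_inv m.+1 (ins v s) w' c1.
Proof.
move=> hs [h2 h3 hc] hv hc1 hr hw'.
have hvc1 : v < c1.
  case: (leqP c1 c) => h; last by lia.
  by have := hr c1 h; rewrite leqnn => /reach_bound; lia.
split; last by lia.
- move=> l t ht; rewrite inc_ins (inc1 _ _ hs) hw'.
  have hut : unbump v t <= c by rewrite /unbump; lia.
  rewrite h2 //; case: (leqP l v) => hl /=; last first.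
    have -> : reach w l (minn t v) = false by apply/negP => /reach_bound; lia.
    (* An old pair above v would form with v a 123 ending before c1. *)
    apply/negP => h; have := reach_bound h; rewrite /unbump => hb.
    have : reach w v (unbump v t) by apply: reach_mono h; rewrite /unbump; lia.
    by rewrite hr // /unbump; lia.
  have -> : unbump v l = l by rewrite /unbump; lia.
  case: (leqP v.+2 t) => htv /=.
    by have -> : [&& v < t, v < unbump v t & v < m] by rewrite /unbump; lia.
  have -> : [&& v < t, v < unbump v t & v < m] = false by rewrite /unbump; lia.
  by congr reach; rewrite /unbump; lia.
move=> t ht; rewrite inc_ins /=; case: (leqP t v) => htv /=.
  have -> : unbump v t = t by rewrite /unbump; lia.
  by rewrite h3; lia.
have -> : unbump v t = t.-1 by rewrite /unbump; lia.
rewrite (_ : unbump v 0 = 0) // h3; last by lia.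
case: (leqP t.-1 c) => htc; last by rewrite orbT; lia.
by rewrite h2 // hr // orbF; lia.
Qed.

Definition good4123 (s : seq nat) := alt s && ~~ has4123 s.

Lemma good4123_ins v s : good4123 (ins v s) =
  [&& (if s is y :: _ then (if odd (size s) then v <= y else y < v) else true),
      ~~ inc 3 0 v s & good4123 s].
Proof.
rewrite /good4123 alt_ins [has4123 _]/= has4123_bump inc_bump negb_or.
have -> : unbump v v = v by rewrite /unbump; lia.
rewrite (_ : unbump v 0 = 0) //.
by case: (if s is _ :: _ then _ else _); case: (inc 3 _ _ _); rewrite ?andbF.
Qed.

Lemma good4123_ins_inv (m v : nat) s :
  is_word m s -> v <= m -> good4123 (ins v s) -> good4123 s.
Proof. by move=> _ _; rewrite good4123_ins => /and3P[]. Qed.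

Definition inv_odd4123 m (s w : seq nat) :=
  [/\ all (leq 1) w, 0 < size w, (if s is y :: _ then stack_top w == y.+2 else false) &
      exists2 c, stack_top w <= c.+1 & stack_inv m s w c].

Definition inv_even4123 m (s u : seq nat) :=
  exists k w, [/\ u = k :: w, all (leq 1) u, 0 < size w,
    (if s is y :: _ then stack_top w == y.+2 else false) & stack_inv m s w ((stack_top w).-1 + k)].

Lemma coded_split m l : odd m -> coded good4123 m l (inv_odd4123 m) ->
  coded good4123 m.+1 (flatten (map stack_splits l)) (inv_even4123 m.+1).
Proof.
move=> hm hl; apply: (coded_step good4123_ins_inv hl) => s w => [hs hg|v hs hg].
  case=> hw hsw hh [c hc [h2 h3 hcm]]; have ss := size_is_word hs.
  apply: filter_iota => [v hv|]; last by lia.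
  (* The constraint v <= c follows from v <= y, since y + 2 = [stack_top w] <= c + 1. *)
  rewrite good4123_ins hg h3 // andbT ss hm.
  by case: s hh {hs h2 h3 hg ss} => // y s /eqP hh; lia.
case=> hw hsw hh [c hc hst] hv; rewrite mem_iota => hvw _.
have hvt : v.+2 <= stack_top w by lia.
have [k [w' [e h1 h2 h3]]] := stack_splitP hw hvt; exists k, w'.
have hck : v.+1 + k <= stack_top w by rewrite -h2; exact: reach_top.
have hb : bounded (stack_top w) w by rewrite /bounded hw leqnn.
have /(splits_bounded hb) : stack_split w v \in stack_splits w.
  by apply: map_f; rewrite mem_iota; lia.
rewrite e => /andP[hs1 /andP[hb1 _]]; split => //; first by rewrite /= h1.
by rewrite h1 /=; apply: (stack_inv_ins hs hst _ _ _ h3); [lia..|move=> t _; exact: h2].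
Qed.

Lemma coded_dec m l : ~~ odd m -> coded good4123 m l (inv_even4123 m) ->
  coded good4123 m.+1 (flatten (map stack_decs l)) (inv_odd4123 m.+1).
Proof.
move=> hm hl; apply: (coded_step good4123_ins_inv hl) => s u => [hs hg|v hs hg].
  case=> k [w [-> hkw hsw hh [h2 h3 hcm]]]; have ss := size_is_word hs.
  apply: filter_iota => [v hv|]; rewrite [behead _]/= [head _ _]/=; last by lia.
  rewrite good4123_ins hg h3 // andbT ss (negbTE hm).
  by case: s hh {hs h2 h3 hg ss} => // y s /eqP hh; lia.
case=> k [w [-> hkw hsw hh hst]] hv; rewrite mem_iota /= => hvw _.
have hw : all (leq 1) w by have /andP[] := hkw.
have ht0 : 0 < stack_top w by case: w hsw {hkw hw hh hst hvw} => // a w _; rewrite top_cons.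
have hvt : stack_top w <= v.+1 by lia.
have [h1 h2 h3] := stack_decP k hsw hw hvt.
have hb : bounded (stack_top (k :: w)) (k :: w) by rewrite /bounded hkw leqnn.
have hs2 : 1 < size (k :: w) by [].
have /(decs_bounded hs2 hb) /andP[hs1 /andP[hb1 _]] : stack_dec (k :: w) v \in stack_decs (k :: w).
  by apply: map_f; rewrite mem_iota /=; lia.
split => //; first by rewrite /= h1.
(* No ascending pair below the least end lies above v, so that end only shifts up by one. *)
exists ((stack_top w).-1 + k).+1; first by rewrite h1; lia.
apply: (stack_inv_ins hs hst _ _ _ h3); [lia..|move=> t ht].
by rewrite h2; lia.
Qed.

Lemma coded_odds4123 n : coded good4123 n.*2.+1 (odds4123 n) (inv_odd4123 n.*2.+1).
Proof.
elim: n => [|n IH]; last first.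
  apply: coded_dec; first by rewrite /= odd_double.
  by apply: coded_split; rewrite //= odd_double.
exists [:: ([:: 0], [:: 1])]; split => // x; rewrite inE => /eqP -> /=; split => //.
exists 1 => //; split => // [l t ht|t ht] /=; rewrite ?andbF ?orbF //; last by lia.
by rewrite /stack_top /=; lia.
Qed.

Lemma card_UD4123 n : #|UD (2 * n.+1) [:: 4; 1; 2; 3]| = size (evens4123 n).
Proof.
have h := coded_split (m := n.*2.+1) _ (coded_odds4123 n).
rewrite -(coded_size (h _)) /= ?odd_double // mul2n; apply: card_words => p.
by rewrite updown_alt ?odd_double // /avoids contains4123.
Qed.

Theorem theorem3p6 (n : nat) :
  #|UD (2 * n) [:: 4; 1; 2; 3]| = #|UD (2 * n) [:: 1; 2; 3; 4]| /\
  (#|UD (2 * n) [:: 1; 2; 3; 4]%N|%:R =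
     (2 * (3 * n)`!)%:R / (n`! * (n.+1)`! * (n.+2)`!)%:R :> rat)%R.
Proof.
split; last by rewrite card_UD1234 size_evens1234 lam_total.
have h1 := size_evens1234 n; rewrite -card_UD1234 in h1.
apply/eqP; rewrite -(eqr_nat rat) h1; apply/eqP.
(* Length 0 is checked directly, since the stacks start from the one-letter word. *)
case: n {h1} => [|n]; last by rewrite card_UD4123 size_evens4123.
rewrite (card_words (good := good4123)) // => p.
by rewrite updown_alt // /avoids contains4123.
Qed.
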